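(* Let $0\le \beta<1$ be fixed. The Glauber dynamics for the Ising model on the complete graph $K_n$ with parameter $\beta$ has a cut-off at $t_n=[2(1-\beta)]^{-1}\,n\log n$ with window size $n$; that is, with $w_n=n$, one has $w_n=o(t_n)$ and $$\lim_{\gamma\to\infty}\liminf_{n\to\infty} d_n(t_n-\gamma n)=1,\qquad \lim_{\gamma\to\infty}\limsup_{n\to\infty} d_n(t_n+\gamma n)=0 .$$
   Context: For an integer $n\ge1$ and $\beta\ge0$ let $\Omega_n=\{-1,1\}^n$ be the set of configurations. The Ising (Curie-Weiss) measure on $K_n$ is the probability measure $\mu_n$ on $\Omega_n$ given by $\mu_n(\sigma)=\frac1{Z(\beta)}\exp\big(\frac{\beta}{n}\sum_{1\le i<j\le n}\sigma(i)\sigma(j)\big)$, with $Z(\beta)$ the normalizing constant. For $\sigma\in\Omega_n$ let $S(\sigma)=\frac1n\sum_{i=1}^n\sigma(i)$, and let $p_+(s)=\frac{1+\tanh(\beta s)}2$. The Glauber dynamics is the Markov chain $(X^n_t)_{t\ge0}$ on $\Omega_n$ which, when at $\sigma$, chooses a site $i\in\{1,\dots,n\}$ uniformly at random and replaces the spin at $i$ by $+1$ with probability $p_+(S(\sigma)-\sigma(i)/n)$ and by $-1$ otherwise, leaving all other spins unchanged. It is reversible with respect to $\mu_n$. $\mathbf P_\sigma$ denotes its law when started at $\sigma$. Set $d_n(t)=\max_{\sigma\in\Omega_n}\|\mathbf P_\sigma(X^n_t\in\cdot)-\mu_n\|_{\rm TV}$, where $\|\cdot\|_{\rm TV}$ is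 total variation distance; for non-integer $t\geq 0$, $d_n(t)$ means $d_n(\lfloor t\rfloor)$. The dynamics exhibits a cut-off at $\{t_n\}$ with window $\{w_n\}$ if $w_n=o(t_n)$, $\lim_{\gamma\to\infty}\liminf_{n\to\infty}d_n(t_n-\gamma w_n)=1$ and $\lim_{\gamma\to\infty}\limsup_{n\to\infty}d_n(t_n+\gamma w_n)=0$. *)

(* Defs.v *)
From HB Require Import structures.
From mathcomp Require Import all_boot all_order all_algebra.
From mathcomp Require Import all_classical all_reals all_analysis.

Set Implicit Arguments.
Unset Strict Implicit.
Unset Printing Implicit Defensive.

Import Order.TTheory GRing.Theory Num.Theory.
Import numFieldNormedType.Exports.

Local Open Scope classical_set_scope.
Local Open Scope ring_scope.

(* Spins are encoded as booleans, [true] for +1 and [false] for -1;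
   [spin] gives the numerical value. *)
Definition config (n : nat) := {ffun 'I_n -> bool}.

Definition spin {R : realType} {n : nat} (s : config n) (i : 'I_n) : R :=
  if s i then 1 else -1.

Definition set_spin {n : nat} (s : config n) (i : 'I_n) (b : bool) : config n :=
  [ffun j => if j == i then b else s j].

Definition boltzmann {R : realType} (beta : R) {n : nat} (s : config n) : R :=
  expR (beta / n%:R *
        \sum_(i < n) \sum_(j < n | (i < j)%N) (spin s i * spin s j)).

Definition partition_function {R : realType} (beta : R) (n : nat) : R :=
  \sum_(s : config n) boltzmann beta s.

Definition ising {R : realType} (beta : R) {n : nat} (s : config n) : R :=
  boltzmann beta s / partition_function beta n.

Definition magnetization {R : realType} {n : nat} (s : config n) : R :=
  n%:R^-1 * \sum_(i < n) spin s i.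

Definition tanh {R : realType} (x : R) : R :=
  (expR x - expR (- x)) / (expR x + expR (- x)).

Definition p_plus {R : realType} (beta s : R) : R := (1 + tanh (beta * s)) / 2.

Definition glauber {R : realType} (beta : R) {n : nat} (s s' : config n) : R :=
  \sum_(i < n) n%:R^-1 *
    (let p := p_plus beta (magnetization s - spin s i / n%:R) in
     p * (s' == set_spin s i true)%:R + (1 - p) * (s' == set_spin s i false)%:R).

(* [law P x t y] is P_x(X_t = y) for the chain with transition matrix P. *)
Fixpoint law {R : realType} {T : finType} (P : T -> T -> R) (x : T) (t : nat)
    (y : T) : R :=
  if t is t'.+1 then \sum_z law P x t' z * P z y else (x == y)%:R.

Definition tv_dist {R : realType} {T : finType} (mu nu : T -> R) : R :=
  \big[Num.max/0]_(A : {set T}) `| \sum_(x in A) mu x - \sum_(x in A) nu x |.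

Definition ising_dist {R : realType} (beta : R) (n t : nat) : R :=
  \big[Num.max/0]_(s : config n) tv_dist (law (glauber beta) s t) (ising beta).

(* [d n k] is the distance to equilibrium of the n-th chain after k steps,
   extended to real times x by d n (floor x) for x >= 0; [Num.truncn x] is 0
   for x < 0. The inferior and superior limits are taken in the extended reals,
   where they always exist. *)
Definition cutoff {R : realType} (d : nat -> nat -> R) (t w : R^nat) : Prop :=
  [/\ w =o_\oo t,
      limn_einf (fun n => (d n (Num.truncn (t n - gamma * w n)))%:E)
        @[gamma --> +oo%R] --> (1%:E : \bar R)
    & limn_esup (fun n => (d n (Num.truncn (t n + gamma * w n)))%:E)
        @[gamma --> +oo%R] --> (0%:E : \bar R)].

(* Main.v *)
(* Let [rho = 1 - (1 - beta) / n].

   Lower bound. The magnetization [S] satisfies [E S(t) ~ rho^t S(0)] for a small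
   initial value, with an error quadratic in [S(0)], and [E S(t)^2] is at most
   [rho^(2t) S(0)^2 + O(1/n)]. Before time [t_n - gamma n] the mean exceeds a large
   multiple of [n^(-1/2)], the order of the fluctuations of [S] at equilibrium, and
   Chebyshev's inequality separates the two laws.

   Upper bound. After a first stage of order [n] the magnetization is at most [1/2]
   in absolute value with high probability, so the starting state [s0] may be
   assumed to have at least [n/4] spins of each sign. The numbers of [+] spins
   among the sites where [s0] is [+] and among those where it is [-] form a Markov
   chain, and by reversibility they carry the whole distance to equilibrium. Two
   copies of this chain are coupled so that their [l^1]-distance [D] changes by at
   most one, contracts on average by [rho], and moves with probability bounded
   below. Used for [n] steps as a random walk that has to hit [0], the coupling
   shows that functions bounded by one become Lipschitz with a constant
   [O(n^(-1/2))]; the remaining [t_n + gamma n - O(n)] steps multiply the constant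
   by [rho] each, and [D <= n]. *)

Require Import Defs.
From HB Require Import structures.
From mathcomp Require Import all_boot all_order all_algebra.
From mathcomp Require Import all_classical all_reals all_analysis.
From mathcomp Require Import ring lra zify.

Set Implicit Arguments.
Unset Strict Implicit.
Unset Printing Implicit Defensive.

Import Order.TTheory GRing.Theory Num.Theory.
Import numFieldNormedType.Exports.

Local Open Scope classical_set_scope.
Local Open Scope ring_scope.

(** * The hyperbolic tangent *)

Section Tanh.
Context {R : realType}.
Implicit Types x y : R.

Lemma tanhE x : tanh x = 1 - 2 / (expR (2 * x) + 1).
Proof.
have e0 := expR_gt0 x.
have -> : 2 * x = x + x by ring.
rewrite /tanh expRN expRD; field.
by apply/andP; split; rewrite gt_eqF//; nra.
Qed.

Lemma tanhN x : tanh (- x) = - tanh x.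
Proof. by rewrite /tanh opprK -mulNr opprB; congr (_ / _); rewrite addrC. Qed.

Lemma tanh0 : tanh 0 = 0 :> R.
Proof. by rewrite /tanh oppr0 subrr mul0r. Qed.

Lemma tanh_bound x : -1 < tanh x < 1.
Proof.
have e0 := expR_gt0 (2 * x).
rewrite tanhE; set e := expR _ in e0 *.
have -> : 1 - 2 / (e + 1) = -1 + 2 * (e / (e + 1)) by field; rewrite gt_eqF// addr_gt0.
have p0 : 0 < e / (e + 1) by rewrite divr_gt0// addr_gt0.
have p1 : e / (e + 1) < 1 by rewrite ltr_pdivrMr ?addr_gt0// mul1r ltrDl.
lra.
Qed.

(* [x |-> x (e^x + 1) - 2 (e^x - 1)] vanishes at [0] and has derivative
   [1 - (1 - x) e^x], which is nonnegative as [1 - x <= e^-x]. *)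
Lemma expRB1_le x : 0 <= x -> 2 * (expR x - 1) <= x * (expR x + 1).
Proof.
move=> x0.
pose k : R -> R := id * (expR + cst 1) - cst 2 * (expR - cst 1).
pose dk (t : R) := 1 + (t - 1) * expR t.
have kd (t : R) : is_derive t 1 k (dk t).
  apply: is_derive_eq; rewrite /dk /= /GRing.scale/=. rewrite !fctE; ring.
have ck : {within `[0, x], continuous k}.
  apply: continuous_subspaceT => t; apply/differentiable_continuous.
  by apply/derivable1_diffP; apply: ex_derive.
have [c] := @MVT_segment R k dk 0 x x0 (fun t _ => kd t) ck.
rewrite in_itv/= => /andP[c0 _] kE.
have dk0 : 0 <= dk c.
  have ec := expR_gt0 c.
  have := expR_ge1Dx (- c); rewrite expRN -(ler_pM2r ec) mulVf ?gt_eqF// /dk.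
  by lra.
have : 0 <= k x - k 0 by rewrite kE mulr_ge0// subr0.
rewrite /k /= /cst /=.
rewrite !(fctE, expR0) /=; lra.
Qed.

Lemma tanh_le x y : x <= y -> tanh x <= tanh y.
Proof.
move=> xy; have e0 := expR_gt0 (2 * x); have e1 := expR_gt0 (2 * y).
rewrite !tanhE lerD2l lerN2 ler_pM2l// lef_pV2 ?posrE ?addr_gt0// lerD2r ler_expR.
by rewrite ler_pM2l.
Qed.

(** Among intervals of a given length, the increment of [tanh] is largest on the one centred at [0],
    where it is [2 (w - 1) / (w + 1)] with [w = exp (y - x)]; [expRB1_le] bounds this by the
    length. *)
Lemma tanhB_le x y : x <= y -> tanh y - tanh x <= y - x.
Proof.
move=> xy; have e0 := expR_gt0 (2 * x).
have d0 : 0 <= y - x by rewrite subr_ge0.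
have w1 : 1 <= expR (y - x) by rewrite leNgt expR_lt1 -leNgt.
have yE : expR (2 * y) = expR (2 * x) * expR (y - x) ^+ 2.
  by rewrite expr2 -!expRD; congr expR; ring.
have := expRB1_le d0.
rewrite !tanhE yE; move: w1 e0; set w := expR (y - x); set A := expR (2 * x).
move=> w1 A0 H.
have w0 : 0 < w by exact: lt_le_trans w1.
have p1 : 0 < A * w ^+ 2 + 1 by rewrite addr_gt0// mulr_gt0// exprn_gt0.
have p2 : 0 < A + 1 by rewrite addr_gt0.
have p3 : 0 < w + 1 by rewrite addr_gt0.
have H2 : 2 * (w - 1) / (w + 1) <= y - x by rewrite ler_pdivrMr.
apply: le_trans H2.
have -> : 1 - 2 / (A * w ^+ 2 + 1) - (1 - 2 / (A + 1)) =
    2 * (w - 1) * (A * (w + 1) / ((A * w ^+ 2 + 1) * (A + 1))).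
  by field; rewrite !gt_eqF.
rewrite ler_wpM2l//; first by rewrite mulr_ge0// subr_ge0.
rewrite -[leRHS]mul1r ler_pdivlMr// mulrAC ler_pdivrMr ?mulr_gt0//.
have := sqr_ge0 (A * w - 1); nra.
Qed.

Lemma tanh_le_id x : 0 <= x -> tanh x <= x.
Proof. by move=> /tanhB_le; rewrite tanh0 !subr0. Qed.

(** For [x >= 0], [exp (2x) >= 1 + 2x] gives [tanh x >= x / (1 + x) >= x - x ^+ 2]; oddness covers
    the other sign. *)
Lemma tanh_quad x : `|tanh x - x| <= x ^+ 2.
Proof.
wlog x0 : x / 0 <= x.
  move=> wl; have [|/ltW x0] := leP 0 x; first exact: wl.
  have -> : tanh x - x = - (tanh (- x) - - x) by rewrite tanhN; ring.
  by rewrite normrN -[x ^+ 2]sqrrN wl// oppr_ge0.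
rewrite distrC ger0_norm ?subr_ge0 ?tanh_le_id//.
have := expR_ge1Dx (2 * x); rewrite tanhE; set e := expR _ => e1.
have : 2 / (e + 1) <= 2 / (2 * x + 2).
  by rewrite ler_pM2l// lef_pV2 ?posrE//; nra.
have : 2 / (2 * x + 2) <= 1 - x + x ^+ 2.
  rewrite ler_pdivrMr; last by nra.
  by rewrite expr2; nra.
lra.
Qed.

Lemma tanh_lip x y : `|tanh x - tanh y| <= `|x - y|.
Proof.
have [xy|/ltW xy] := leP x y.
  by rewrite !ler0_norm ?subr_le0 ?tanh_le// !opprB tanhB_le.
by rewrite !ger0_norm ?subr_ge0 ?tanh_le// tanhB_le.
Qed.

Lemma mul_tanh_le b x : 0 <= b -> x * tanh (b * x) <= b * x ^+ 2.
Proof.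
move=> b0; wlog x0 : x / 0 <= x.
  move=> wl; have [|/ltW x0] := leP 0 x; first exact: wl.
  by have := wl (- x); rewrite oppr_ge0 mulrN tanhN mulrNN sqrrN; apply.
have := tanh_le_id (mulr_ge0 b0 x0); nra.
Qed.

End Tanh.

(** * Markov operators and total variation *)

Section MarkovOperator.
Context {R : realType} {T : finType}.
Implicit Types (P : T -> T -> R) (f g : T -> R).

Definition markov_op P f : T -> R := fun x => \sum_y P x y * f y.

(** The iterate is the expectation of [f] at time [t]; through it, later estimates act on functions
    rather than on laws. *)
Lemma law_expect P x t f :
  \sum_y law P x t y * f y = iter t (markov_op P) f x.
Proof.
elim: t f => [|t IH] f /=.
  rewrite (bigD1 x)//= eqxx mul1r big1 ?addr0// => y yx.
  by rewrite eq_sym (negbTE yx) mul0r.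
rewrite -iterS iterSr -IH /markov_op.
under eq_bigr do rewrite mulr_suml.
rewrite exchange_big; apply: eq_bigr => z _.
by rewrite mulr_sumr; apply: eq_bigr => y _; rewrite mulrA.
Qed.

Lemma markov_op_const P c : (forall x, \sum_y P x y = 1) ->
  markov_op P (fun=> c) =1 fun=> c.
Proof. by move=> P1 x; rewrite /markov_op -mulr_suml P1 mul1r. Qed.

Lemma markov_op_le P f g : (forall x y, 0 <= P x y) ->
  (forall x, f x <= g x) -> forall x, markov_op P f x <= markov_op P g x.
Proof. by move=> P0 fg x; apply: ler_sum => y _; rewrite ler_wpM2l. Qed.

Lemma iter_markov_le P t f g : (forall x y, 0 <= P x y) ->
  (forall x, f x <= g x) ->
  forall x, iter t (markov_op P) f x <= iter t (markov_op P) g x.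
Proof.
by move=> P0 fg; elim: t => //= t IH x; exact: markov_op_le.
Qed.

Lemma markov_op_lin P a b f g x :
  markov_op P (fun y => a * f y + b * g y) x =
  a * markov_op P f x + b * markov_op P g x.
Proof.
by rewrite /markov_op !mulr_sumr -big_split; apply: eq_bigr => y _ /=; ring.
Qed.

Lemma law_ge0 P x t y : (forall x y, 0 <= P x y) -> 0 <= law P x t y.
Proof.
move=> P0; elim: t y => [|t IH] y /=; first by case: eqP.
by apply: sumr_ge0 => z _; rewrite mulr_ge0.
Qed.

Lemma law_sum P x t : (forall x, \sum_y P x y = 1) -> \sum_y law P x t y = 1.
Proof.
move=> P1; have := law_expect P x t (fun=> 1).
under eq_bigr do rewrite mulr1.
move=> ->; elim: t x => //= t IH x.
rewrite -{2}(markov_op_const 1 P1 x); apply: eq_bigr => y _.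
by rewrite IH.
Qed.

Lemma stationary_iter P (mu : T -> R) f t :
  (forall y, \sum_x mu x * P x y = mu y) ->
  \sum_x mu x * iter t (markov_op P) f x = \sum_x mu x * f x.
Proof.
move=> st; elim: t => //= t <-; rewrite /markov_op.
under eq_bigr do rewrite mulr_sumr.
rewrite exchange_big; apply: eq_bigr => y _.
by under eq_bigr do rewrite mulrA; rewrite -mulr_suml st.
Qed.

(** Detailed balance makes the operator self-adjoint for [mu], so densities with respect to [mu]
    evolve by the same operator as functions. *)
Lemma reversible_density P (mu : T -> R) x t y : (forall y, mu y != 0) ->
  (forall x y, mu x * P x y = mu y * P y x) ->
  law P x t y = mu y * iter t (markov_op P) (fun z => (x == z)%:R / mu x) y.
Proof.
move=> mu0 rev; elim: t y => [|t IH] y /=.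
  by case: eqP => [->|_]; rewrite ?mul0r ?mulr0// mul1r mulfV.
rewrite /markov_op mulr_sumr; apply: eq_bigr => z _.
by rewrite IH mulrAC rev; ring.
Qed.

End MarkovOperator.

(** * Total variation distance *)

Section TotalVariation.
Context {R : realType} {T : finType}.
Implicit Types (mu nu : T -> R) (A : {set T}).

Lemma tv_dist_ge mu nu A :
  `| \sum_(x in A) mu x - \sum_(x in A) nu x | <= tv_dist mu nu.
Proof. by rewrite /tv_dist; apply: le_bigmax. Qed.

Lemma tv_dist_le mu nu (c : R) : 0 <= c ->
  (forall A, `| \sum_(x in A) mu x - \sum_(x in A) nu x | <= c) ->
  tv_dist mu nu <= c.
Proof. by move=> c0 H; apply: bigmax_le. Qed.

Definition prob mu := (forall x, 0 <= mu x) /\ \sum_x mu x = 1.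

Lemma prob_bound mu A : prob mu -> 0 <= \sum_(x in A) mu x <= 1.
Proof.
move=> [mu0 <-]; rewrite sumr_ge0//= [leRHS](bigID (mem A))/=.
by rewrite lerDl sumr_ge0.
Qed.

Lemma tv_dist_le1 mu nu : prob mu -> prob nu -> tv_dist mu nu <= 1.
Proof.
move=> pm pn; apply: tv_dist_le => // A.
have /andP[a0 a1] := prob_bound A pm; have /andP[b0 b1] := prob_bound A pn.
by rewrite ler_norml; apply/andP; split; lra.
Qed.

(* An event carries at most the mass of the positive part of [mu - nu]; apply
   this to the event and to its complement. *)
Lemma tv_dist_pos mu nu : prob mu -> prob nu ->
  tv_dist mu nu <= \sum_x (mu x - nu x) * (0 <= mu x - nu x)%R%:R.
Proof.
move=> [_ m1] [_ n1].
have key (A : {set T}) : \sum_(x in A) mu x - \sum_(x in A) nu x <=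
    \sum_x (mu x - nu x) * (0 <= mu x - nu x)%R%:R.
  rewrite -sumrB [leRHS](bigID (mem A))/= -[leLHS]addr0 lerD//; last first.
    apply: sumr_ge0 => x _.
    by have [h|h] := leP 0 (mu x - nu x); rewrite ?mulr1 ?mulr0.
  by apply: ler_sum => x _; have [h|/ltW h] := leP 0 (mu x - nu x); rewrite ?mulr1 ?mulr0.
apply: tv_dist_le.
  by have := key finset.set0; rewrite !finset.big_set0 subrr.
move=> A; rewrite ler_norml key andbT.
rewrite lerNl opprB; apply: le_trans (key (finset.setC A)).
have e (f : T -> R) : \sum_(x in finset.setC A) f x = \sum_x f x - \sum_(x in A) f x.
  rewrite [in RHS](bigID (mem A))/= addrAC subrr add0r.
  by apply: eq_bigl => x; rewrite inE.
by rewrite !e m1 n1; lra.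
Qed.

End TotalVariation.

(** * Glauber dynamics *)

Section Glauber.
Context {R : realType} (beta : R) {n : nat}.
Implicit Types (s : config n) (i : 'I_n).

Definition flip s i : config n := set_spin s i (~~ s i).

(* The local field at [i]: the sum of the other spins, divided by [n]. *)
Definition cavity s i : R := magnetization s - spin s i / n%:R.

Definition flip_rate s i : R :=
  n%:R^-1 * (if s i then 1 - p_plus beta (cavity s i)
             else p_plus beta (cavity s i)).

Lemma p_plus_bound (x : R) : 0 < p_plus beta x < 1.
Proof. have := tanh_bound (beta * x); rewrite /p_plus; lra. Qed.

Lemma flip_rate_le s i : flip_rate s i <= n%:R^-1.
Proof.
have := p_plus_bound (cavity s i); rewrite /flip_rate => /andP[p0 p1].
by rewrite -[leRHS]mulr1 ler_wpM2l ?invr_ge0//; case: ifP; lra.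
Qed.

Lemma set_spin_id s i : set_spin s i (s i) = s.
Proof. by apply/ffunP => j; rewrite ffunE; case: eqP => // ->. Qed.

Lemma glauber_ge0 s s' : 0 <= glauber beta s s'.
Proof.
apply: sumr_ge0 => i _; rewrite mulr_ge0 ?invr_ge0//.
have /andP[p0 p1] := p_plus_bound (magnetization s - spin s i / n%:R).
by rewrite addr_ge0// mulr_ge0//; lra.
Qed.

(** Resampling a spin to its present value changes nothing, so only flips contribute increments. *)
Lemma glauber_opE (f : config n -> R) s : (0 < n)%N ->
  markov_op (glauber beta) f s =
  f s + \sum_i flip_rate s i * (f (flip s i) - f s).
Proof.
move=> n0; have nn0 : n%:R != 0 :> R by rewrite pnatr_eq0 -lt0n.
transitivity (\sum_(i < n) (n%:R^-1 * f s + flip_rate s i * (f (flip s i) - f s))); last first.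
  by rewrite big_split /= sumr_const card_ord -[_ *+ n]mulr_natl mulrA mulfV ?mul1r.
rewrite /markov_op /glauber.
under eq_bigr do rewrite mulr_suml.
rewrite exchange_big; apply: eq_bigr => i _ /=.
have E (b : bool) : \sum_y (y == set_spin s i b)%:R * f y = f (set_spin s i b).
  rewrite (bigD1 (set_spin s i b))//= eqxx mul1r big1 ?addr0// => y yb.
  by rewrite (negbTE yb) mul0r.
rewrite /flip_rate /flip -/(cavity s i); set p := p_plus _ _.
transitivity (n%:R^-1 * (p * f (set_spin s i true) + (1 - p) * f (set_spin s i false))).
  rewrite -!E !mulr_sumr -big_split /= mulr_sumr.
  by apply: eq_bigr => y _; ring.
by have := set_spin_id s i; case: (s i) => /= ->; ring.
Qed.

Lemma glauber_sum s : (0 < n)%N -> \sum_y glauber beta s y = 1.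
Proof.
move=> n0; have := glauber_opE (fun=> 1) s n0.
rewrite /markov_op; under eq_bigr do rewrite mulr1.
by move=> ->; rewrite big1 ?addr0// => i _; rewrite subrr mulr0.
Qed.

Lemma spin_sqr s i : spin s i ^+ 2 = 1 :> R.
Proof. by rewrite /spin; case: (s i); rewrite ?sqrrN expr1n. Qed.

Lemma sum_spinE s : (0 < n)%N -> \sum_i spin s i = n%:R * magnetization s :> R.
Proof. by move=> n0; rewrite /magnetization mulrA mulfV ?mul1r// pnatr_eq0 -lt0n. Qed.

Lemma pair_sum s : \sum_(i < n) \sum_(j < n | (i < j)%N) (spin s i * spin s j) =
  ((\sum_i spin s i) ^+ 2 - n%:R) / 2 :> R.
Proof.
set X := LHS.
have XE : X = \sum_(i < n) \sum_(j < n | (j < i)%N) (spin s i * spin s j).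
  rewrite /X (exchange_big_dep xpredT)//=; apply: eq_bigr => i _.
  by apply: eq_bigr => j _; rewrite mulrC.
have -> : (\sum_i spin s i) ^+ 2 = X + X + n%:R :> R.
  rewrite expr2 mulr_suml {2}XE -big_split /=.
  have -> : n%:R = \sum_(i < n) 1 :> R by rewrite sumr_const card_ord.
  rewrite -big_split; apply: eq_bigr => i _ /=; rewrite mulr_sumr.
  rewrite (bigD1 i)//= -expr2 spin_sqr addrC; congr (_ + 1).
  rewrite (bigID (fun j : 'I_n => (i < j)%N))/=; congr (_ + _).
    by apply: eq_bigl => j; rewrite -val_eqE /=; lia.
  by apply: eq_bigl => j; rewrite -val_eqE /=; lia.
by field.
Qed.

Lemma sum_set_spin s i b :
  \sum_j spin (set_spin s i b) j =
  \sum_j spin s j - spin s i + (if b then 1 else -1) :> R.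
Proof.
rewrite (bigD1 i)//= [in RHS](bigD1 i)//= addrC [spin s i + _]addrC addrK.
congr (_ + _); last by rewrite /spin ffunE eqxx.
by apply: eq_bigr => j ji; rewrite /spin ffunE (negbTE ji).
Qed.

Lemma cavity_set_spin s i b : cavity (set_spin s i b) i = cavity s i.
Proof.
rewrite /cavity /magnetization sum_set_spin /spin ffunE eqxx.
by ring.
Qed.

Lemma p_plusE (x : R) : p_plus beta x = expR (beta * x) / (expR (beta * x) + expR (- (beta * x))).
Proof.
have e0 := expR_gt0 (beta * x); have e1 := expR_gt0 (- (beta * x)).
by rewrite /p_plus /tanh; field; rewrite gt_eqF// addr_gt0.
Qed.

Lemma partition_gt0 : 0 < partition_function beta n.
Proof.
apply: (@lt_le_trans _ _ (boltzmann beta ([ffun=> true] : config n))).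
  exact: expR_gt0.
rewrite /partition_function (bigD1 [ffun=> true])//= lerDl sumr_ge0// => s _.
exact: expR_ge0.
Qed.

Lemma ising_gt0 s : 0 < ising beta s.
Proof. by rewrite divr_gt0 ?expR_gt0 ?partition_gt0. Qed.

Lemma ising_prob : prob (@ising R beta n).
Proof.
split=> [s|]; first exact/ltW/ising_gt0.
by rewrite -mulr_suml mulfV// gt_eqF ?partition_gt0.
Qed.

Lemma law_prob s t : (0 < n)%N -> prob (law (glauber beta) s t).
Proof.
move=> n0; split=> [s'|]; first by apply: law_ge0; exact: glauber_ge0.
by apply: law_sum => x; exact: glauber_sum.
Qed.

(** Detailed balance at one site: given the other spins, the weights of [+] and [-] at [i] stand in
    the ratio of [p_plus] to [1 - p_plus] at the cavity field. *)
Lemma boltzmann_set_spin s i : (0 < n)%N ->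
  boltzmann beta (set_spin s i true) * expR (- (beta * cavity s i)) =
  boltzmann beta (set_spin s i false) * expR (beta * cavity s i).
Proof.
move=> n0; rewrite /boltzmann !pair_sum !sum_set_spin -!expRD; congr expR.
rewrite /cavity /magnetization; field.
by rewrite pnatr_eq0 -lt0n.
Qed.

Lemma glauber_reversible s s' : (0 < n)%N ->
  ising beta s * glauber beta s s' = ising beta s' * glauber beta s' s.
Proof.
move=> n0; rewrite /ising mulrAC [RHS]mulrAC; congr (_ / _).
rewrite /glauber !mulr_sumr; apply: eq_bigr => i _.
rewrite mulrCA [RHS]mulrCA; congr (_ * _) => /=.
rewrite -!/(cavity _ i).
(* If the two configurations differ off [i], the [i]-th term vanishes on both sides. *)
have [eqs|neqs] := boolP [forall j, (j != i) ==> (s' j == s j)]; last first.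
  have ne b (t t' : config n) : ~~ [forall j, (j != i) ==> (t' j == t j)] ->
      (t' == set_spin t i b) = false.
    move=> H; apply/negbTE; apply: contra H => /eqP ->; apply/forallP => j.
    by apply/implyP => ji; rewrite ffunE (negbTE ji).
  have neqs' : ~~ [forall j, (j != i) ==> (s j == s' j)].
    by apply: contra neqs => /forallP H; apply/forallP => j; have := H j; rewrite [s j == _]eq_sym.
  by rewrite !(ne _ _ _ neqs) !(ne _ _ _ neqs') !mulr0 addr0 !mulr0.
have s'E : s' = set_spin s i (s' i).
  apply/ffunP => j; rewrite ffunE; case: eqP => [->//|/eqP ji].
  by have /forallP/(_ j) := eqs; rewrite ji => /eqP.
have cs : cavity s' i = cavity s i by rewrite s'E cavity_set_spin.
have ss b c : (set_spin s i b == set_spin s i c) = (b == c).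
  apply/eqP/eqP => [/ffunP/(_ i)|-> //]; by rewrite !ffunE eqxx.
have set2 b c : set_spin (set_spin s i b) i c = set_spin s i c.
  by apply/ffunP => j; rewrite !ffunE; case: eqP.
have W := boltzmann_set_spin s i n0.
have H b c : boltzmann beta (set_spin s i b) *
   (p_plus beta (cavity s i) * (set_spin s i c == set_spin s i true)%:R +
    (1 - p_plus beta (cavity s i)) * (set_spin s i c == set_spin s i false)%:R) =
   boltzmann beta (set_spin s i c) *
   (p_plus beta (cavity s i) * (set_spin s i b == set_spin (set_spin s i c) i true)%:R +
    (1 - p_plus beta (cavity s i)) * (set_spin s i b == set_spin (set_spin s i c) i false)%:R).
  rewrite !set2 !ss p_plusE.
  have e0 := expR_gt0 (beta * cavity s i).
  have e1 := expR_gt0 (- (beta * cavity s i)).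
  move: e0 e1 W; set x := expR _; set y := expR (- _) => e0 e1 W.
  have xy : x + y != 0 by rewrite gt_eqF// addr_gt0.
  have -> : 1 - x / (x + y) = y / (x + y) by field.
  case: b; case: c; rewrite /= ?mulr0 ?mulr1 ?addr0 ?add0r//.
    by rewrite mulrA W mulrA.
  by rewrite mulrA -W mulrA.
by have := H (s i) (s' i); rewrite -s'E set_spin_id cs.
Qed.

Lemma ising_stationary (n0 : (0 < n)%N) f t :
  \sum_(s : config n) ising beta s * iter t (markov_op (glauber beta)) f s =
  \sum_s ising beta s * f s.
Proof.
apply: stationary_iter => s.
under eq_bigr do rewrite glauber_reversible//.
by rewrite -mulr_sumr glauber_sum// mulr1.
Qed.

End Glauber.

(** * Moments of the magnetization *)

Section MarkovIterate.
Context {R : realType} {T : finType} (P : T -> T -> R).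
Hypothesis P0 : forall x y, 0 <= P x y.
Hypothesis P1 : forall x, \sum_y P x y = 1.

Lemma iter_markov_lin t (a b : R) f g x :
  iter t (markov_op P) (fun y => a * f y + b * g y) x =
  a * iter t (markov_op P) f x + b * iter t (markov_op P) g x.
Proof.
elim: t x => //= t IH x; rewrite -markov_op_lin.
by rewrite /markov_op; apply: eq_bigr => y _; rewrite IH.
Qed.

Lemma iter_markov_const t (c : R) x : iter t (markov_op P) (fun=> c) x = c.
Proof.
elim: t x => //= t IH x; rewrite -[RHS](markov_op_const c P1 x).
by rewrite /markov_op; apply: eq_bigr => y _; rewrite IH.
Qed.

Lemma markov_chebyshev (mu f : T -> R) (c : R) (A : {set T}) :
  (forall x, 0 <= mu x) -> (forall x, 0 <= f x) ->
  (forall x, x \in A -> c <= f x) ->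
  c * \sum_(x in A) mu x <= \sum_x mu x * f x.
Proof.
move=> mu0 f0 cf; rewrite [leRHS](bigID (mem A))/= -[leLHS]addr0 lerD//.
  by rewrite mulr_sumr ler_sum// => x xA; rewrite mulrC ler_wpM2l ?cf.
by rewrite sumr_ge0// => x _; rewrite mulr_ge0.
Qed.

End MarkovIterate.

Section Moments.
Context {R : realType} (beta : R) (n : nat).
Hypothesis beta01 : 0 <= beta < 1.
Hypothesis n2 : (1 < n)%N.
Implicit Types (s : config n) (i : 'I_n).

Local Notation mag := (@magnetization R n).
Local Notation N := (n%:R : R).
Local Notation P := (@markov_op R _ (@glauber R beta n)).
Local Notation rho := (1 - (1 - beta) / N).
Local Notation gap := (1 - beta).

Let n0 : (0 < n)%N. Proof. exact: ltnW. Qed.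
Let N0 : 0 < N. Proof. by rewrite ltr0n. Qed.
Let Nn0 : N != 0. Proof. by rewrite gt_eqF. Qed.
Let Vn0 : 0 < N^-1. Proof. by rewrite invr_gt0. Qed.
Let Vn2 : N^-1 <= 2^-1. Proof. by rewrite lef_pV2 ?posrE// ler_nat. Qed.

Lemma spin_norm s i : `|spin s i| = 1 :> R.
Proof. by rewrite /spin; case: (s i); rewrite ?normrN normr1. Qed.

Lemma magnetization_norm s : `|mag s| <= 1.
Proof.
rewrite /magnetization normrM gtr0_norm//.
rewrite mulrC ler_pdivrMr// mul1r (le_trans (ler_norm_sum _ _ _))//.
under eq_bigr do rewrite spin_norm.
by rewrite sumr_const card_ord.
Qed.

Lemma magnetization_flip s i : mag (flip s i) = mag s - 2 * spin s i / N.
Proof.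
rewrite /magnetization sum_set_spin /spin.
by case: (s i) => /=; ring.
Qed.

(** A resampled spin has mean [tanh] of [beta] times its cavity field, and each site is chosen with
    probability [1 / n]. *)
Lemma flip_drift s i : flip_rate beta s i * (- 2 * spin s i / N) =
  N^-1 ^+ 2 * (tanh (beta * cavity s i) - spin s i).
Proof. by rewrite /flip_rate /p_plus /spin; case: (s i); field. Qed.

Lemma magnetization_drift s : P mag s =
  mag s - mag s / N + N^-1 ^+ 2 * \sum_i tanh (beta * cavity s i).
Proof.
rewrite glauber_opE//.
under eq_bigr => i _.
  rewrite magnetization_flip addrAC subrr add0r -mulNr -mulNr flip_drift mulrBr.
  over.
by rewrite /= sumrB -!mulr_sumr sum_spinE//; field.
Qed.

Lemma sum_cavity s : \sum_i cavity s i = (N - 1) * mag s.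
Proof.
rewrite sumrB sumr_const card_ord -mulr_suml sum_spinE// -[_ *+ n]mulr_natl.
by field.
Qed.

(** Linearizing [tanh] by [tanh_quad] costs at most [2 mag s ^+ 2 + 2 / N ^+ 2] at each site;
    removing each spin from its own field costs another [O(1 / N ^+ 2)]. *)
Lemma magnetization_step_ge s :
  rho * mag s - 3 / N * mag s ^+ 2 - 3 / N ^+ 2 <= P mag s.
Proof.
rewrite magnetization_drift.
have H i : beta * cavity s i - 2 * mag s ^+ 2 - 2 * N^-1 ^+ 2 <= tanh (beta * cavity s i).
  have := tanh_quad (beta * cavity s i); rewrite ler_norml => /andP[+ _].
  have : (beta * cavity s i) ^+ 2 <= cavity s i ^+ 2.
    by rewrite exprMn ler_piMl ?sqr_ge0//; move: beta01 => ?; nra.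
  have : cavity s i ^+ 2 <= 2 * mag s ^+ 2 + 2 * N^-1 ^+ 2.
    rewrite /cavity; have := sqr_ge0 (mag s + spin s i / N).
    have : (spin s i / N) ^+ 2 = N^-1 ^+ 2 by rewrite exprMn spin_sqr mul1r.
    by set u := mag s; set v := spin s i / N => <-; nra.
  by lra.
have : N * (-2 * mag s ^+ 2 - 2 * N^-1 ^+ 2) + beta * ((N - 1) * mag s) <=
    \sum_i tanh (beta * cavity s i).
  have SC (c : R) : N * c = \sum_(i < n) c by rewrite sumr_const card_ord mulr_natl.
  rewrite -sum_cavity mulr_sumr SC -big_split.
  by apply: ler_sum => i _ /=; have := H i; lra.
rewrite -(ler_pM2l (exprn_gt0 2 Vn0)) => H2.
have := magnetization_norm s; rewrite ler_norml => /andP[m1 m2].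
set X := _ * \sum_i _ in H2 *.
have : rho * mag s - 3 / N * mag s ^+ 2 - 3 / N ^+ 2 <= mag s - mag s / N +
   N^-1 ^+ 2 * (N * (-2 * mag s ^+ 2 - 2 * N^-1 ^+ 2) + beta * ((N - 1) * mag s)).
  have -> : 3 / N ^+ 2 = 3 * N^-1 ^+ 2 by rewrite exprVn.
  have -> : N^-1 ^+ 2 * (N * (-2 * mag s ^+ 2 - 2 * N^-1 ^+ 2) + beta * ((N - 1) * mag s)) =
     N^-1 * (-2 * mag s ^+ 2 - 2 * N^-1 ^+ 2) + beta * (N^-1 - N^-1 ^+ 2) * mag s by field.
  move: Vn0 Vn2; set v := N^-1 => v0 v2.
  have b1 : beta * mag s <= 1 by move: beta01 => ?; nra.
  have : v ^+ 2 * (beta * mag s) <= v ^+ 2 by rewrite ler_piMr ?sqr_ge0.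
  have : v * v ^+ 2 <= v ^+ 2 by rewrite ler_piMl ?sqr_ge0//; lra.
  have : 0 <= v * mag s ^+ 2 by rewrite mulr_ge0 ?sqr_ge0// ltW.
  by have := sqr_ge0 v; lra.
by lra.
Qed.

(** The product [mag s * tanh (beta * mag s)] is at most [beta * mag s ^+ 2] whatever the sign. In
    the constant [6], [4] comes from the squared jump [2 / N] and [2] from replacing the cavity
    field by [mag s]. *)
Lemma magnetization_sqr_step_le s :
  P (fun s => mag s ^+ 2) s <= rho ^+ 2 * mag s ^+ 2 + 6 / N ^+ 2.
Proof.
rewrite glauber_opE//.
have -> : 6 / N ^+ 2 = 6 * N^-1 ^+ 2 by rewrite exprVn.
have H i : flip_rate beta s i * (mag (flip s i) ^+ 2 - mag s ^+ 2) <=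
    N^-1 ^+ 2 * (2 * (mag s * (tanh (beta * cavity s i) - spin s i)) + 4 * N^-1).
  have -> : mag (flip s i) ^+ 2 - mag s ^+ 2 =
     2 * mag s * (-2 * spin s i / N) + 4 * N^-1 ^+ 2 * spin s i ^+ 2.
    by rewrite magnetization_flip; field.
  rewrite spin_sqr mulr1 mulrDr mulrCA flip_drift.
  have := flip_rate_le beta s i.
  have := sqr_ge0 N^-1; set w := N^-1 ^+ 2; set v := N^-1 => w0 fv.
  have : w * flip_rate beta s i <= w * v by rewrite ler_wpM2l.
  by lra.
apply: (@le_trans _ _ (mag s ^+ 2 + \sum_i
   N^-1 ^+ 2 * (2 * (mag s * (tanh (beta * cavity s i) - spin s i)) + 4 * N^-1))).
  by rewrite lerD2l ler_sum.
rewrite -mulr_sumr big_split /= -mulr_sumr -mulr_sumr sumrB sum_spinE//.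
rewrite sumr_const card_ord -[(4 / N) *+ n]mulr_natl.
have K : mag s * \sum_i tanh (beta * cavity s i) <= N * (beta * mag s ^+ 2) + 1.
  have SC (c : R) : N * c = \sum_(i < n) c by rewrite sumr_const card_ord mulr_natl.
  have -> : N * (beta * mag s ^+ 2) + 1 = N * (beta * mag s ^+ 2 + N^-1) by field.
  rewrite SC mulr_sumr; apply: ler_sum => i _.
  have /andP[b0 b1] := beta01.
  have T1 := mul_tanh_le (mag s) b0.
  have T2 := tanh_lip (beta * cavity s i) (beta * mag s).
  have T3 : `|beta * cavity s i - beta * mag s| <= N^-1.
    rewrite -mulrBr normrM ger0_norm// /cavity addrAC subrr add0r normrN.
    by rewrite normrM spin_norm mul1r gtr0_norm// ler_piMl ?ltW.
  have T4 : mag s * (tanh (beta * cavity s i) - tanh (beta * mag s)) <= N^-1.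
    apply: (le_trans (ler_norm _)); rewrite normrM.
    rewrite -[leRHS]mul1r ler_pM ?magnetization_norm//.
    exact: le_trans T3.
  by lra.
have -> : N^-1 ^+ 2 * (2 * (mag s * (\sum_i tanh (beta * cavity s i) - N * mag s)) + N * (4 / N)) =
  N^-1 ^+ 2 * (2 * (mag s * \sum_i tanh (beta * cavity s i))) - 2 * N^-1 * mag s ^+ 2 + 4 * N^-1 ^+ 2 by field.
have := ler_wpM2l (sqr_ge0 N^-1) K.
have -> : N^-1 ^+ 2 * (N * (beta * mag s ^+ 2) + 1) = N^-1 * (beta * mag s ^+ 2) + N^-1 ^+ 2 by field.
(* Adding this square completes [1 - 2 gap / N] to [rho ^+ 2]. *)
have : 0 <= (gap / N) ^+ 2 * mag s ^+ 2 by rewrite mulr_ge0 ?sqr_ge0.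
set v := N^-1; set Y := \sum_i _; set m := mag s => ? ?.
by nra.
Qed.

End Moments.

(** * Lower bound *)

Section LowerBound.
Context {R : realType} (beta : R) (n : nat).
Hypothesis beta01 : 0 <= beta < 1.
Hypothesis n2 : (1 < n)%N.
Implicit Types (s : config n) (i : 'I_n).

Local Notation mag := (@magnetization R n).
Local Notation N := (n%:R : R).
Local Notation P := (@markov_op R _ (@glauber R beta n)).
Local Notation rho := (1 - (1 - beta) / N).
Local Notation gap := (1 - beta).
(** [C2 / N] and [B / N] absorb the additive errors of one step:
    [6 / N ^+ 2 <= (1 - rho ^+ 2) C2 / N] and [3 (C2 + 1) / N ^+ 2 = (1 - rho) B / N]. *)
Local Notation C2 := (6 / gap).
Local Notation B := (3 * (C2 + 1) / gap).

Let n0 : (0 < n)%N. Proof. exact: ltnW. Qed.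
Let N0 : 0 < N. Proof. by rewrite ltr0n. Qed.
Let Nn0 : N != 0. Proof. by rewrite gt_eqF. Qed.
Let N2 : 2 <= N. Proof. by rewrite ler_nat. Qed.
Let Vn0 : 0 < N^-1. Proof. by rewrite invr_gt0. Qed.
Let Vn2 : N^-1 <= 2^-1. Proof. by rewrite lef_pV2 ?posrE. Qed.
Let gap0 : 0 < gap. Proof. by move: beta01; lra. Qed.
Let gapn0 : gap != 0. Proof. by rewrite gt_eqF. Qed.

Lemma rho_bound : 2^-1 <= rho <= 1.
Proof. by move: Vn0 Vn2 beta01 => ? ? ?; apply/andP; split; nra. Qed.

Let B0 : 0 <= B.
Proof.
apply: divr_ge0; last exact: ltW.
by rewrite mulr_ge0// addr_ge0// divr_ge0// ltW.
Qed.

Let P0 := @glauber_ge0 R beta n.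
Let P1 := fun s => @glauber_sum R beta n s n0.

Lemma iter_markov_affine_le t (a b : R) f g s :
  (forall s, P f s <= a * g s + b) ->
  iter t.+1 P f s <= a * iter t P g s + b.
Proof.
move=> H; rewrite iterSr.
rewrite -[leRHS](congr1 (fun c => _ + c) (iter_markov_const P1 t b s)) -[X in _ + X]mul1r -iter_markov_lin//.
by apply: iter_markov_le => // s'; rewrite mul1r.
Qed.

Lemma magnetization_sqr_le t s :
  iter t P (fun s => mag s ^+ 2) s <= rho ^+ (2 * t) * mag s ^+ 2 + C2 / N.
Proof.
have /andP[r0 r1] := rho_bound.
elim: t => [|t IH]; first by rewrite muln0 expr0 mul1r lerDl !divr_ge0// ltW.
have := iter_markov_affine_le t s (magnetization_sqr_step_le beta01 n2).
move/le_trans; apply.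
rewrite mulnS exprD -mulrA.
have := ler_wpM2l (sqr_ge0 rho) IH; rewrite mulrDr.
suff : rho ^+ 2 * (C2 / N) + 6 / N ^+ 2 <= C2 / N by lra.
have -> : 6 / N ^+ 2 = 6 * N^-1 ^+ 2 by rewrite exprVn.
have -> : rho ^+ 2 * (C2 / N) + 6 * N^-1 ^+ 2 = C2 / N - 6 * N^-1 ^+ 2 * (1 - gap / N).
  by field; rewrite Nn0.
by rewrite lerBlDr lerDl !mulr_ge0// ?sqr_ge0//; lra.
Qed.

(** Stationarity puts the same second moment on both sides of the one-step bound, and
    [1 - rho ^+ 2 >= gap / N]. *)
Lemma ising_sqr_le : \sum_s ising beta s * mag s ^+ 2 <= C2 / N.
Proof.
have [mu0 mu1] := @ising_prob R beta n.
have st : \sum_s ising beta s * P (fun s => mag s ^+ 2) s =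
    \sum_s ising beta s * mag s ^+ 2 by exact: (ising_stationary beta n0 _ 1).
set E := \sum_s ising beta s * mag s ^+ 2 in st *.
have : E <= rho ^+ 2 * E + 6 / N ^+ 2.
  have -> : 6 / N ^+ 2 = \sum_(s : config n) ising beta s * (6 / N ^+ 2).
    by rewrite -mulr_suml mu1 mul1r.
  rewrite -[leLHS]st /E mulr_sumr -big_split; apply: ler_sum => s _ /=.
  by rewrite mulrCA -mulrDr ler_wpM2l// magnetization_sqr_step_le.
have -> : 6 / N ^+ 2 = 6 * N^-1 ^+ 2 by rewrite exprVn.
have /andP[r0 r1] := rho_bound => H.
have H2 : E * (gap / N) <= 6 * N^-1 ^+ 2.
  have : 0 <= E by apply: sumr_ge0 => s _; rewrite mulr_ge0 ?sqr_ge0.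
  by move: H r0 r1; set x := gap / N => ? ? ? ?; nra.
have -> : C2 / N = 6 * N^-1 ^+ 2 / (gap / N) by field; rewrite Nn0.
by rewrite ler_pdivlMr// divr_gt0.
Qed.

(* The term in [mag s ^+ 2] accounts for the curvature of [tanh]: its increment
   over one step is of order [rho ^+ (2 * t) * mag s ^+ 2 / n], which is what
   [magnetization_sqr_le] allows for the second moment. *)
Lemma magnetization_mean_ge t s :
  rho ^+ t * mag s - 6 / gap * mag s ^+ 2 * (rho ^+ t * (1 - rho ^+ t)) - B / N
  <= iter t P mag s.
Proof.
have /andP[r0 r1] := rho_bound.
elim: t => [|t IH].
  rewrite !expr0 subrr !mulr0 subr0 mul1r lerBlDr lerDl.
  exact: divr_ge0.
have S : rho * iter t P mag s - 3 / N * iter t P (fun s => mag s ^+ 2) s - 3 / N ^+ 2 <= iter t.+1 P mag s.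
  rewrite iterSr.
  rewrite -[X in _ - X](iter_markov_const P1 t (3 / N ^+ 2) s).
  rewrite -[X in _ - X]mul1r -!mulNr -!iter_markov_lin//.
  rewrite -[X in X + _]mul1r -iter_markov_lin//.
  apply: iter_markov_le => // s'.
  have := magnetization_step_ge beta01 n2 s'; lra.
apply: le_trans S.
have M2 := magnetization_sqr_le t s.
set E2 := iter t P _ s in M2 *; set E1 := iter t P _ s in IH *.
have -> : 3 / N ^+ 2 = 3 * N^-1 ^+ 2 by rewrite exprVn.
have r0' : 0 <= rho by apply: le_trans r0; rewrite invr_ge0.
have IH2 := ler_wpM2l r0' IH.
have e1 : 6 / gap * (1 - rho) = 6 * N^-1 by field; rewrite Nn0.
have e2 : B / N * (1 - rho) = 3 * (C2 * N^-1 + N^-1) * N^-1 by field; rewrite Nn0.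
have H3 := ler_wpM2l (ltW Vn0) M2.
rewrite mulnC exprM in H3; rewrite exprS.
set w := rho ^+ t in IH2 H3 *.
have e3 : 6 / gap * mag s ^+ 2 * (rho * w * (1 - rho * w)) =
   rho * (6 / gap * mag s ^+ 2 * (w * (1 - w))) +
   6 / gap * (1 - rho) * (rho * (w ^+ 2 * mag s ^+ 2)) by ring.
(* The extra factor [rho] is at least [1/2], which accounts for [6 / gap] where [3 / gap] might be
   expected. *)
have h4 : 3 * N^-1 * (w ^+ 2 * mag s ^+ 2) <= 6 * N^-1 * (rho * (w ^+ 2 * mag s ^+ 2)).
  have : 0 <= N^-1 * (w ^+ 2 * mag s ^+ 2) by rewrite mulr_ge0 ?(ltW Vn0)// mulr_ge0 ?sqr_ge0.
  by move: r0; set r := rho; set W := w ^+ 2 * _; set v := N^-1 => ? ?; nra.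
rewrite e1 in e3; rewrite e3.
lra.
Qed.

(** This controls the first stage: the bound is small once [t] is a large multiple of [n] and [n] is
    large. *)
Lemma magnetization_large_prob t s :
  4^-1 * \sum_(y in [set y : config n | 2^-1 < `|mag y|]%SET) law (glauber beta) s t y
  <= rho ^+ (2 * t) + C2 / N.
Proof.
have [l0 l1] := law_prob beta s t n0.
apply: (@le_trans _ _ (\sum_y law (glauber beta) s t y * mag y ^+ 2)).
  apply: markov_chebyshev => // y; first exact: sqr_ge0.
  rewrite inE => y2; rewrite -[mag y ^+ 2]real_normK ?num_real//.
  by move: y2; set u := `|_| => ?; nra.
rewrite law_expect (le_trans (magnetization_sqr_le t s))// lerD2r.
have /andP[r0 r1] := rho_bound.
rewrite -[leRHS]mulr1 ler_wpM2l//; first by rewrite exprn_ge0//; apply: le_trans r0; rewrite invr_ge0.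
have m1 : `|mag s| <= 1 by exact: magnetization_norm.
rewrite -[mag s ^+ 2]real_normK ?num_real//.
by rewrite exprn_ile1.
Qed.

(* Chebyshev's inequality around [a = rho ^+ t * mag s]: the variance is
   [O (mag s)] relative to [a ^+ 2], so [mag s] has to be taken small. *)
Lemma ising_dist_ge t s : 0 < mag s ->
  1 - 48 / gap * mag s - (48 / gap + 8 * B) / (N * (rho ^+ t * mag s) ^+ 2)
  <= ising_dist beta n t.
Proof.
move=> s0; have /andP[r0 r1] := rho_bound.
have r00 : 0 < rho by apply: lt_le_trans r0; rewrite invr_gt0.
apply: (@le_trans _ _ (tv_dist (law (glauber beta) s t) (ising beta))); last first.
  by rewrite /ising_dist; apply: (le_bigmax _ (fun s => tv_dist (law (glauber beta) s t) (ising beta))).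
set a := rho ^+ t * mag s.
have a0 : 0 < a by rewrite mulr_gt0// exprn_gt0.
have [l0 l1] := law_prob beta s t n0.
have [mu0 mu1] := @ising_prob R beta n.
pose A : {set config n} := [set y | mag y <= a / 2]%SET.
have low : a ^+ 2 / 4 * \sum_(y in A) law (glauber beta) s t y <=
    12 / gap * mag s * a ^+ 2 + (6 / gap + 2 * B) / N.
  apply: (@le_trans _ _ (\sum_y law (glauber beta) s t y * (mag y - a) ^+ 2)).
    apply: markov_chebyshev => // y; first exact: sqr_ge0.
    rewrite inE => ya; nra.
  (* In the expanded square the main terms [a ^+ 2], [- 2 a ^+ 2] and [a ^+ 2] cancel, leaving only
     errors. *)
  rewrite (_ : \sum_y _ = \sum_y law (glauber beta) s t y * mag y ^+ 2
     - 2 * a * \sum_y law (glauber beta) s t y * mag y + a ^+ 2); last first.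
    rewrite [X in _ = _ + X](_ : _ = \sum_y law (glauber beta) s t y * a ^+ 2).
      by rewrite mulr_sumr -sumrB -big_split; apply: eq_bigr => y _ /=; ring.
    by rewrite -mulr_suml l1 mul1r.
  rewrite !law_expect.
  have M1 := magnetization_mean_ge t s; have M2 := magnetization_sqr_le t s.
  have a1 : a <= 1.
    rewrite /a -[leRHS]mulr1 ler_pM ?exprn_ge0// ?(ltW s0)// ?(ltW r00)//.
      by rewrite exprn_ile1// ltW.
    by rewrite -(gtr0_norm s0) magnetization_norm.
  rewrite mulnC exprM -exprMn -/a in M2.
  have M1' : a - 6 / gap * mag s * a - B / N <= iter t P mag s.
    apply: le_trans M1; rewrite -/a lerD2r lerD2l lerN2.
    have -> : 6 / gap * mag s ^+ 2 * (rho ^+ t * (1 - rho ^+ t)) =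
      6 / gap * mag s * a * (1 - rho ^+ t) by rewrite /a; ring.
    rewrite ler_piMr//; first by apply: mulr_ge0; rewrite ?(ltW a0)// mulr_ge0// ?(ltW s0)// divr_ge0// ltW.
    by rewrite gerBl exprn_ge0// ltW.
  have M3 := ler_wpM2l (ltW a0) M1'.
  have : B / N * a <= B / N by rewrite ler_piMr// divr_ge0.
  by lra.
have up : a ^+ 2 / 4 * \sum_(y in finset.setC A) ising beta y <= 6 / gap / N.
  apply: (le_trans _ ising_sqr_le).
  apply: markov_chebyshev => // y; first exact: sqr_ge0.
  rewrite !inE -ltNge => ya; nra.
have C (f : config n -> R) : \sum_(x in finset.setC A) f x = \sum_x f x - \sum_(x in A) f x.
  rewrite [in RHS](bigID (mem A))/= addrAC subrr add0r.
  by apply: eq_bigl => x; rewrite inE.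
(* The test event is [mag > a / 2], likely under the dynamics and unlikely at equilibrium. *)
apply: le_trans (tv_dist_ge _ _ (finset.setC A)).
apply: le_trans (ler_norm _).
rewrite [X in _ <= X - _]C l1.
set p := \sum_(y in A) _ in low *; set q := \sum_(y in _) _ in up *.
have a20 : 0 < a ^+ 2 by rewrite exprn_gt0.
have -> : 48 / gap * mag s = (12 / gap * mag s * a ^+ 2) / (a ^+ 2 / 4).
  by field; rewrite gapn0 gt_eqF.
have -> : (48 / gap + 8 * B) / (N * a ^+ 2) =
  ((6 / gap + 2 * B) / N + 6 / gap / N) / (a ^+ 2 / 4).
  by field; rewrite gapn0 Nn0 gt_eqF.
have a40 : 0 < a ^+ 2 / 4 by rewrite divr_gt0.
rewrite mulrC -ler_pdivlMr// in low; rewrite mulrC -ler_pdivlMr// in up.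
set D := (a ^+ 2 / 4)^-1 in low up *; lra.
Qed.

End LowerBound.

(** * Coupling of the chain of counts *)

Section CountChain.
Context {R : realType} (beta : R) {C : finType} (Nc : C -> nat) (n : nat).
Local Notation N := (n%:R : R).
Local Notation state := {ffun C -> nat}.
Implicit Types (x y : state) (c : C) (b : bool) (m : C * bool).

(* The sites are split into classes of sizes [Nc c], and the state of the chain
   records the number [x c] of [+] spins in each class. The move [(c, true)] turns
   one spin of the class [c] to [+], the move [(c, false)] turns one to [-]. *)
Definition count_dom x := forall c, (x c <= Nc c)%N.

Definition total x : nat := \sum_c x c.

Definition count_move x m : state :=
  [ffun d => if d == m.1 then (if m.2 then (x d).+1 else (x d).-1) else x d].

(** The field is [(2 total - N) / N] without the spin to be updated: dropping a [-] spin adds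
    [1 / N], dropping a [+] spin subtracts it. *)
Definition p_up x : R := p_plus beta ((2 * (total x)%:R + 1 - N) / N).
Definition p_down x : R := p_plus beta ((2 * (total x)%:R - 1 - N) / N).

Definition count_rate x m : R :=
  if m.2 then ((Nc m.1)%:R - (x m.1)%:R) / N * p_up x
  else (x m.1)%:R / N * (1 - p_down x).

Definition count_op (g : state -> R) x : R :=
  g x + \sum_m count_rate x m * (g (count_move x m) - g x).

(** The [l^1]-distance: one of the two truncated differences is always [0]. *)
Definition count_dist x y : nat := \sum_c ((x c - y c) + (y c - x c))%N.

Lemma count_distC x y : count_dist x y = count_dist y x.
Proof. by apply: eq_bigr => c _; rewrite addnC. Qed.

Lemma count_rate_ge0 x m : count_dom x -> 0 <= count_rate x m.
Proof.
move=> xd; rewrite /count_rate; case: ifP => _.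
  have /andP[p0 _] := p_plus_bound beta ((2 * (total x)%:R + 1 - N) / N).
  by rewrite mulr_ge0 ?(ltW p0)// divr_ge0// subr_ge0 ler_nat.
have /andP[_ p1] := p_plus_bound beta ((2 * (total x)%:R - 1 - N) / N).
by rewrite mulr_ge0 ?divr_ge0// subr_ge0 ltW.
Qed.

(** Excludes moves that leave the domain and the down move at [0], which the truncated predecessor
    makes trivial; moves of nonzero rate are genuine. *)
Definition genuine x m := if m.2 then (x m.1 < Nc m.1)%N else (0 < x m.1)%N.

Lemma count_rate_genuine x m : count_dom x -> count_rate x m != 0 -> genuine x m.
Proof.
move=> xd; rewrite /count_rate /genuine; case: ifP => _ H; last first.
  by rewrite lt0n; apply: contra H => /eqP ->; rewrite !mul0r.
rewrite ltn_neqAle xd andbT; apply: contra H => /eqP ->.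
by rewrite subrr !mul0r.
Qed.

Lemma genuine_dom x m : count_dom x -> genuine x m -> count_dom (count_move x m).
Proof.
move=> xd gx c; rewrite ffunE; have xc := xd c; case: eqP => // ?; subst.
by move: gx; rewrite /genuine; case: m.2; lia.
Qed.

(** On a tie no move is toward: every single genuine move then increases the distance. *)
Definition toward x y m := if m.2 then (x m.1 < y m.1)%N else (y m.1 < x m.1)%N.

Lemma count_distD1 x y c : count_dist x y =
  (((x c - y c) + (y c - x c)) + \sum_(d | d != c) ((x d - y d) + (y d - x d)))%N.
Proof. by rewrite /count_dist (bigD1 c). Qed.

Lemma count_dist_move x y m : genuine x m -> count_dist (count_move x m) y =
  if toward x y m then (count_dist x y).-1 else (count_dist x y).+1.
Proof.
move=> gx; rewrite (count_distD1 x y m.1) (count_distD1 _ y m.1).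
rewrite [X in (_ + X)%N](eq_bigr (fun d => (x d - y d) + (y d - x d))%N); last first.
  by move=> d dm; rewrite ffunE (negbTE dm).
rewrite ffunE eqxx; move: gx; rewrite /genuine /toward; set S := \sum_(d | d != m.1) _; case: m.2 => /= H; case: ifP; lia.
Qed.

Lemma count_dist_move2 x y m : genuine x m -> genuine y m ->
  count_dist (count_move x m) (count_move y m) = count_dist x y.
Proof.
move=> gx gy; rewrite (count_distD1 x y m.1) (count_distD1 _ _ m.1).
rewrite [X in (_ + X)%N](eq_bigr (fun d => (x d - y d) + (y d - x d))%N); last first.
  by move=> d dm; rewrite !ffunE (negbTE dm).
rewrite !ffunE eqxx; move: gx gy; rewrite /genuine; case: m.2 => /= *; lia.
Qed.

Lemma count_dist_eq0 x y : (count_dist x y == 0)%N = (x == y).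
Proof.
rewrite /count_dist sum_nat_eq0; apply/forallP/eqP => [H|-> c]; last by rewrite subnn.
by apply/ffunP => c; have := H c; rewrite /=; lia.
Qed.

Lemma total_dist x y : (total x)%:R - (total y)%:R <= (count_dist x y)%:R :> R.
Proof.
rewrite lerBlDr -natrD ler_nat /total /count_dist -big_split /=.
by apply: leq_sum => c _; lia.
Qed.

(* Where the two counts differ, only half of the common rate is shared: the
   distance then fluctuates at a rate bounded below, while the total mass of
   the coupled moves stays at most one. *)
Definition common x y m : R :=
  (if x m.1 == y m.1 then 1 else 2^-1) * Num.min (count_rate x m) (count_rate y m).

Lemma commonC x y m : common x y m = common y x m.
Proof. by rewrite /common eq_sym minC. Qed.

Lemma common_ge0 x y m : count_dom x -> count_dom y -> 0 <= common x y m.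
Proof.
move=> xd yd; rewrite mulr_ge0//; first by case: ifP => _; rewrite ?invr_ge0.
by rewrite le_min !count_rate_ge0.
Qed.

Lemma common_le x y m : count_dom x -> count_dom y -> common x y m <= count_rate x m.
Proof.
move=> xd yd; rewrite /common.
have [h0 h1] := (count_rate_ge0 m xd, count_rate_ge0 m yd).
set w := Num.min _ _.
have w0 : 0 <= w by rewrite le_min h0 h1.
have w1 : w <= count_rate x m by rewrite ge_min lexx.
by case: ifP => _; lra.
Qed.

Lemma common_genuine x y m : count_dom x -> count_dom y -> common x y m != 0 ->
  genuine x m && genuine y m.
Proof.
move=> xd yd c0.
have H z w : count_dom z -> count_dom w -> common z w m != 0 -> genuine z m.
  move=> zd wd cn; apply: count_rate_genuine => //; apply: contra cn => /eqP r0.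
  by rewrite eq_le common_ge0// andbT -r0 common_le.
by rewrite (H x y)// (H y x)// commonC.
Qed.

Definition alone x y m : R := count_rate x m - common x y m.

Lemma alone_ge0 x y m : count_dom x -> count_dom y -> 0 <= alone x y m.
Proof. by move=> xd yd; rewrite subr_ge0 common_le. Qed.

Lemma alone_genuine x y m : count_dom x -> count_dom y -> alone x y m != 0 ->
  genuine x m.
Proof.
move=> xd yd a0; apply: count_rate_genuine => //; apply: contra a0 => /eqP r0.
have := alone_ge0 m xd yd; have := common_ge0 m xd yd.
by rewrite /alone r0 => h1 h2; apply/eqP; lra.
Qed.

Definition away_mass x y := \sum_m (alone x y m * (~~ toward x y m)%:R +
                                    alone y x m * (~~ toward y x m)%:R).
Definition toward_mass x y := \sum_m (alone x y m * (toward x y m)%:R +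
                                    alone y x m * (toward y x m)%:R).
Definition coupled_mass x y := \sum_m (common x y m + alone x y m + alone y x m).

(* The coupling: with probability [common x y m] both chains make the move [m],
   with probability [alone x y m] only the first one does. No step makes the
   coordinates cross, so the distance changes by at most one. *)
Lemma count_op_coupling x y (g : state -> R) (psi : nat -> R) :
  count_dom x -> count_dom y -> coupled_mass x y <= 1 ->
  (forall x y, count_dom x -> count_dom y -> `|g x - g y| <= psi (count_dist x y)) ->
  `|count_op g x - count_op g y| <=
  psi (count_dist x y)
     + away_mass x y * (psi (count_dist x y).+1 - psi (count_dist x y))
     + toward_mass x y * (psi (count_dist x y).-1 - psi (count_dist x y)).
Proof.
move=> xd yd T1 H; set D := count_dist x y.
(* [common] and [alone] add up to the rate of each chain; with the remaining mass
   [1 - coupled_mass x y] both chains stay. *)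
have -> : count_op g x - count_op g y = (1 - coupled_mass x y) * (g x - g y) +
   \sum_m (common x y m * (g (count_move x m) - g (count_move y m)) +
     alone x y m * (g (count_move x m) - g y) + alone y x m * (g x - g (count_move y m))).
  rewrite /count_op /coupled_mass mulrBl mul1r mulr_suml opprD addrACA -!sumrB.
  rewrite -[RHS]addrA; congr (_ + _); rewrite -sumrN -big_split /=.
  by apply: eq_bigr => m _; rewrite /alone [common y x m]commonC; ring.
have hD : `|g x - g y| <= psi D by exact: H.
have step z w m : count_dom z -> count_dom w -> alone z w m *
    `|g (count_move z m) - g w| <= alone z w m *
    (if toward z w m then psi (count_dist z w).-1 else psi (count_dist z w).+1).
  move=> zd wd; have [->|a0] := eqVneq (alone z w m) 0; first by rewrite !mul0r.
  have gz := alone_genuine zd wd a0.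
  rewrite ler_wpM2l ?alone_ge0//.
  have := H _ _ (genuine_dom zd gz) wd; rewrite count_dist_move//.
  by case: ifP.
apply: (le_trans (ler_normD _ _)).
rewrite normrM ger0_norm ?subr_ge0//.
have hT : (1 - coupled_mass x y) * `|g x - g y| <= (1 - coupled_mass x y) * psi D.
  by rewrite ler_wpM2l ?subr_ge0.
apply: le_trans (lerD hT (ler_norm_sum _ _ _)) _.
have -> : psi D + away_mass x y * (psi D.+1 - psi D) + toward_mass x y * (psi D.-1 - psi D)
  = (1 - coupled_mass x y) * psi D + \sum_m (common x y m * psi D +
      alone x y m * (if toward x y m then psi D.-1 else psi D.+1) +
      alone y x m * (if toward y x m then psi D.-1 else psi D.+1)) :> R.
  rewrite /coupled_mass /away_mass /toward_mass mulrBl mul1r.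
  rewrite !mulr_suml -!addrA; congr (_ + _).
  rewrite -sumrN -!big_split /=; apply: eq_bigr => m _.
  by case: (toward x y m); case: (toward y x m) => /=; ring.
rewrite lerD2l; apply: ler_sum => m _.
apply: (le_trans (ler_normD _ _)); apply: lerD.
  apply: (le_trans (ler_normD _ _)); apply: lerD.
    rewrite normrM ger0_norm ?common_ge0//.
    have [->|c0] := eqVneq (common x y m) 0; first by rewrite !mul0r.
    have /andP[gx gy] := common_genuine xd yd c0.
    rewrite ler_wpM2l ?common_ge0//.
    have := H _ _ (genuine_dom xd gx) (genuine_dom yd gy).
    by rewrite count_dist_move2.
  by rewrite normrM ger0_norm ?alone_ge0// step.
rewrite normrM ger0_norm ?alone_ge0// distrC.
by have := step _ _ m yd xd; rewrite count_distC.
Qed.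

Lemma sum_moves (F : C * bool -> R) :
  \sum_m F m = \sum_c (F (c, true) + F (c, false)).
Proof.
transitivity (\sum_c \sum_b F (c, b)); last by apply: eq_bigr => c _; rewrite big_bool.
by rewrite pair_big; apply: eq_bigr => -[].
Qed.

Hypothesis beta01 : 0 <= beta < 1.
Hypothesis n2 : (1 < n)%N.
Hypothesis Ncn : (\sum_c Nc c = n)%N.

Let n0 : (0 < n)%N. Proof. exact: ltnW. Qed.
Let N0 : 0 < N. Proof. by rewrite ltr0n. Qed.
Let Nn0 : N != 0. Proof. by rewrite gt_eqF. Qed.
Let Vn0 : 0 < N^-1. Proof. by rewrite invr_gt0. Qed.

Lemma sum_Nc : \sum_c (Nc c)%:R = N.
Proof. by rewrite -natr_sum Ncn. Qed.

Lemma total_le x : count_dom x -> (total x)%:R <= N.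
Proof. by move=> xd; rewrite ler_nat -Ncn leq_sum. Qed.

Lemma p_plus_lip (s t d : R) : s - t <= 2 * d / N -> 0 <= d ->
  p_plus beta s - p_plus beta t <= beta * d / N.
Proof.
move=> st d0; have /andP[b0 b1] := beta01; rewrite /p_plus.
have [lt|lt] := leP s t.
  have := @tanh_le R (beta * s) (beta * t).
  rewrite ler_wpM2l// => /(_ isT).
  have : 0 <= beta * d / N by rewrite divr_ge0// mulr_ge0.
  lra.
have := @tanhB_le R (beta * t) (beta * s).
rewrite ler_wpM2l ?(ltW lt)// => /(_ isT).
have := ler_wpM2l b0 st; lra.
Qed.

Lemma p_up_lip x y : p_up x - p_up y <= beta * (count_dist x y)%:R / N.
Proof.
apply: p_plus_lip => //; rewrite -mulrBl ler_pM2r//.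
by have := total_dist x y; lra.
Qed.

Lemma p_down_lip x y : p_down x - p_down y <= beta * (count_dist x y)%:R / N.
Proof.
apply: p_plus_lip => //; rewrite -mulrBl ler_pM2r//.
by have := total_dist x y; lra.
Qed.

Lemma p_down_le_up x : p_down x <= p_up x.
Proof.
have /andP[b0 b1] := beta01.
rewrite /p_down /p_up /p_plus ler_pM2r// lerD2l; apply: tanh_le.
by rewrite ler_wpM2l// ler_pM2r//; lra.
Qed.

(** Drift of the distance due to moves in the class [c]; joint moves leave the distance
    unchanged. *)
Definition class_net x y c : R :=
  \sum_(b : bool) (alone x y (c, b) * ((~~ toward x y (c, b))%:R - (toward x y (c, b))%:R) +
    alone y x (c, b) * ((~~ toward y x (c, b))%:R - (toward y x (c, b))%:R)).

Lemma class_netC x y c : class_net x y c = class_net y x c.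
Proof. by apply: eq_bigr => b _; rewrite addrC. Qed.

(** The discrepancy in the class relaxes at rate [1 / N], while the difference of the fields shifts
    the update probability at each of its [Nc c] sites by at most [beta * count_dist x y / N]. *)
Lemma class_net_le x y c : count_dom x -> count_dom y ->
  class_net x y c <= (beta * (count_dist x y)%:R / N * (Nc c)%:R -
     ((x c - y c) + (y c - x c))%:R) / N.
Proof.
wlog xy : x y / (y c <= x c)%N.
  move=> wl xd yd; have [yx|/ltnW yx] := leqP (y c) (x c); first exact: wl.
  by rewrite class_netC count_distC addnC; exact: wl.
move=> xd yd.
have -> : ((x c - y c) + (y c - x c))%N = (x c - y c)%N by lia.
rewrite natrB// /class_net big_bool /= /toward /alone/= ![common y x _]commonC.
set w := beta * _ / N.
have U1 : p_up x - p_up y <= w by exact: p_up_lip.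
have U2 : p_up y - p_up x <= w by rewrite /w count_distC; exact: p_up_lip.
have D1 : p_down x - p_down y <= w by exact: p_down_lip.
have D2 : p_down y - p_down x <= w by rewrite /w count_distC; exact: p_down_lip.
have DU := p_down_le_up x.
have y0 : 0 <= (y c)%:R :> R by [].
have ya : (y c)%:R <= (x c)%:R :> R by rewrite ler_nat.
have xa : (x c)%:R <= (Nc c)%:R :> R by rewrite ler_nat.
(* On a tie all single moves go away, but [common] is the full minimum, so only the differences of
   the rates remain. *)
move: xy; rewrite leq_eqVlt => /orP[/eqP e|lt].
  rewrite /common /= e eqxx ltnn /= !subr0 !mulr1 /count_rate /= e.
  rewrite !mul1r.
  have minE (a b : R) : a - Num.min a b + (b - Num.min a b) = `|a - b|.
    have [ab|/ltW ab] := leP a b; first by rewrite ler0_norm; lra.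
    by rewrite ger0_norm; lra.
  have i0 : 0 <= (x c)%:R / N :> R by rewrite divr_ge0.
  have i1 : 0 <= ((Nc c)%:R - (x c)%:R) / N :> R by rewrite divr_ge0// subr_ge0.
  rewrite !minE -mulrBr -mulrBr [`|(x c)%:R / N * _|]normrM (ger0_norm i0).
  rewrite normrM (ger0_norm i1).
  have N1 : `|p_up x - p_up y| <= w by rewrite ler_norml; apply/andP; split; lra.
  have N2' : `|1 - p_down x - (1 - p_down y)| <= w by rewrite ler_norml; apply/andP; split; lra.
  have := ler_wpM2l i0 N2'; have := ler_wpM2l i1 N1.
  by lra.
rewrite lt ltnNge (ltnW lt) /= !(subr0, sub0r, mulr1, mulrN1).
rewrite /count_rate /=.
set a := (Nc c)%:R in xa *; set u := (x c)%:R in ya xa *; set v := (y c)%:R in y0 ya *.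
set k1 := common _ _ _; set k2 := common _ _ _.
(* A move in a given direction is away for one chain and toward for the other, so the shared rates
   [k1] and [k2] cancel. *)
have -> : (a - u) / N * p_up x - k1 - ((a - v) / N * p_up y - k1) +
    (- (u / N * (1 - p_down x) - k2) + (v / N * (1 - p_down y) - k2)) =
    (- (u - v) + (a - u) * (p_up x - p_up y) + v * (p_down x - p_down y) +
      (u - v) * (p_down x - p_up y)) / N by ring.
rewrite ler_pM2r//.
have : (a - u) * (p_up x - p_up y) <= (a - u) * w by rewrite ler_wpM2l// subr_ge0.
have : v * (p_down x - p_down y) <= v * w by rewrite ler_wpM2l.
have : (u - v) * (p_down x - p_up y) <= (u - v) * w by rewrite ler_wpM2l ?subr_ge0//; lra.
by lra.
Qed.

Lemma coupling_drift x y : count_dom x -> count_dom y ->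
  away_mass x y - toward_mass x y <= - (1 - beta) * (count_dist x y)%:R / N.
Proof.
move=> xd yd; rewrite -sumrB.
have -> : - (1 - beta) * (count_dist x y)%:R / N = \sum_c (beta * (count_dist x y)%:R / N * (Nc c)%:R -
     ((x c - y c) + (y c - x c))%:R) / N.
  by rewrite -mulr_suml sumrB -mulr_sumr sum_Nc -natr_sum -/(count_dist x y); field.
rewrite sum_moves; apply: ler_sum => c _; apply: le_trans (class_net_le c xd yd).
by rewrite /class_net big_bool /=; lra.
Qed.

End CountChain.

(** * Bounds on the rates and on the mass of the coupling *)

Section CountChainMass.
Context {R : realType} (beta : R) {C : finType} (Nc : C -> nat) (n : nat).
Hypothesis beta01 : 0 <= beta < 1.
Hypothesis n2 : (1 < n)%N.
Hypothesis Ncn : (\sum_c Nc c = n)%N.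

Local Notation N := (n%:R : R).
Local Notation state := {ffun C -> nat}.
(** A lower bound for the probability of either update value, valid since all fields lie in
    [[-2, 2]] and [beta < 1]. *)
Local Notation pmin := ((1 - tanh 2) / 2 : R).
Local Notation dom := (count_dom Nc).
Local Notation rate := (count_rate beta Nc n).
Implicit Types (x y : state) (c : C) (b : bool) (m : C * bool).

Let n0 : (0 < n)%N. Proof. exact: ltnW. Qed.
Let N0 : 0 < n%:R :> R. Proof. by rewrite ltr0n. Qed.
Let Nn0 : N != 0. Proof. by rewrite gt_eqF. Qed.
Let N2 : 2 <= n%:R :> R. Proof. by rewrite ler_nat. Qed.
Let Vn0 : 0 < n%:R^-1 :> R. Proof. by rewrite invr_gt0. Qed.

Lemma pmin_gt0 : 0 < pmin.
Proof. have := @tanh_bound R 2; lra. Qed.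

Lemma p_plus_ge (s : R) : -2 <= s <= 2 -> pmin <= p_plus beta s <= 1 - pmin.
Proof.
move=> /andP[s0 s1]; have /andP[b0 b1] := beta01.
have : tanh (beta * s) <= tanh 2 by apply: tanh_le; nra.
have : tanh (- 2) <= tanh (beta * s) by apply: tanh_le; nra.
by rewrite tanhN /p_plus; lra.
Qed.

Lemma p_up_ge x : dom x -> pmin <= p_up beta n x <= 1 - pmin.
Proof.
move=> xd; apply: p_plus_ge; have := @total_le R _ _ _ Ncn _ xd => T.
have T0 : 0 <= (total x)%:R :> R by [].
have N2' := N2.
rewrite ler_pdivlMr// ler_pdivrMr//. by apply/andP; split; lra.
Qed.

Lemma p_down_ge x : dom x -> pmin <= p_down beta n x <= 1 - pmin.
Proof.
move=> xd; apply: p_plus_ge; have := @total_le R _ _ _ Ncn _ xd => T.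
have T0 : 0 <= (total x)%:R :> R by [].
have N2' := N2.
by rewrite ler_pdivlMr// ler_pdivrMr//; apply/andP; split; lra.
Qed.

Lemma rate_sum_ge x c : dom x ->
  pmin * (Nc c)%:R / N <= rate x (c, true) + rate x (c, false).
Proof.
move=> xd; rewrite /count_rate /=.
have /andP[u _] := p_up_ge xd; have /andP[_ d] := p_down_ge xd.
have x0 : 0 <= (x c)%:R :> R by [].
have xa : (x c)%:R <= (Nc c)%:R :> R by rewrite ler_nat.
rewrite [leRHS](_ : _ = (((Nc c)%:R - (x c)%:R) * p_up beta n x +
   (x c)%:R * (1 - p_down beta n x)) / N); last by ring.
rewrite ler_pM2r//; nra.
Qed.

(** If [y c <= x c], the states share [Nc c - x c] spins [-] and [y c] spins [+] in the class, each
    flipping in both with probability at least [pmin] when chosen. *)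
Lemma rate_min_ge x y c : dom x -> dom y ->
  pmin * ((Nc c)%:R - ((x c - y c) + (y c - x c))%:R) / N <=
  Num.min (rate x (c, true)) (rate y (c, true)) +
  Num.min (rate x (c, false)) (rate y (c, false)).
Proof.
wlog xy : x y / (y c <= x c)%N.
  move=> wl xd yd; have [yx|/ltnW yx] := leqP (y c) (x c); first exact: wl.
  rewrite addnC minC [Num.min _ (rate y (c, false))]minC; exact: wl.
move=> xd yd.
have -> : ((x c - y c) + (y c - x c))%N = (x c - y c)%N by lia.
rewrite natrB//.
have /andP[ux _] := p_up_ge xd; have /andP[_ dx] := p_down_ge xd.
have /andP[uy _] := p_up_ge yd; have /andP[_ dy] := p_down_ge yd.
have y0 : 0 <= (y c)%:R :> R by [].
have ya : (y c)%:R <= (x c)%:R :> R by rewrite ler_nat.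
have xa : (x c)%:R <= (Nc c)%:R :> R by rewrite ler_nat.
have p0 := pmin_gt0.
have H1 : ((Nc c)%:R - (x c)%:R) / N * pmin <= Num.min (rate x (c, true)) (rate y (c, true)).
  rewrite le_min /count_rate /=; apply/andP; split.
    by rewrite ler_wpM2l// divr_ge0// subr_ge0.
  apply: ler_pM; rewrite ?(ltW p0)// ?divr_ge0 ?subr_ge0//.
  by rewrite ler_pM2r// lerD2l lerN2.
have H2 : (y c)%:R / N * pmin <= Num.min (rate x (c, false)) (rate y (c, false)).
  rewrite le_min /count_rate /=; apply/andP; split; last first.
    by rewrite ler_wpM2l ?divr_ge0//; lra.
  apply: ler_pM; rewrite ?(ltW p0)// ?divr_ge0//; last by lra.
  by rewrite ler_pM2r.
apply: le_trans (lerD H1 H2).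
by set u := (x c)%:R; set v := (y c)%:R; set a := (Nc c)%:R; lra.
Qed.

(** The field favours the majority, so a uniformly chosen spin flips with probability at most [1/2],
    up to the discrepancy between [p_up] and [p_down]. *)
Lemma rate_total_le x : dom x -> \sum_m rate x m <= 2^-1 + N^-1.
Proof.
move=> xd; rewrite sum_moves.
rewrite (_ : \sum_c _ = ((N - (total x)%:R) * p_up beta n x +
    (total x)%:R * (1 - p_down beta n x)) / N); last first.
  have -> : N - (total x)%:R = \sum_c ((Nc c)%:R - (x c)%:R).
    by rewrite sumrB (@sum_Nc R _ _ _ Ncn) /total natr_sum.
  rewrite [(total x)%:R]natr_sum !mulr_suml -big_split /= mulr_suml.
  by apply: eq_bigr => c _; rewrite /count_rate/=; ring.
rewrite ler_pdivrMr// [leRHS](_ : _ = N / 2 + 1); last by field.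
have T0 : 0 <= (total x)%:R :> R by [].
have T1 := @total_le R _ _ _ Ncn _ xd.
have /andP[b0 b1] := beta01.
have L : p_up beta n x - p_down beta n x <= beta * 1 / N.
  by apply: p_plus_lip => //; rewrite -mulrBl ler_pM2r//; lra.
have L2 : (total x)%:R * (p_up beta n x - p_down beta n x) <= 1.
  have : (total x)%:R * (p_up beta n x - p_down beta n x) <= N * (beta * 1 / N).
    apply: (@le_trans _ _ ((total x)%:R * (beta * 1 / N))); first by rewrite ler_wpM2l.
    by rewrite ler_wpM2r// mulr1 divr_ge0.
  rewrite (_ : N * (beta * 1 / N) = beta); last by field.
  by lra.
suff : (N - 2 * (total x)%:R) * (p_up beta n x - 2^-1) <= 0 by lra.
have puE : p_up beta n x - 2^-1 = tanh (beta * ((2 * (total x)%:R + 1 - N) / N)) / 2.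
  by rewrite /p_up /p_plus; field.
(* By integrality [2 total + 1 - n] and [2 total - n] never have strictly opposite signs. *)
rewrite puE; have [le|lt] := leqP n (2 * total x).
  have le' : N <= 2 * (total x)%:R by rewrite -natrM ler_nat.
  have : 0 <= tanh (beta * ((2 * (total x)%:R + 1 - N) / N)).
    by rewrite -[X in X <= _](@tanh0 R) tanh_le// mulr_ge0// divr_ge0//; lra.
  by nra.
have lt' : 2 * (total x)%:R + 1 <= N by rewrite -natrM natr1 ler_nat.
have : tanh (beta * ((2 * (total x)%:R + 1 - N) / N)) <= 0.
  rewrite -[X in _ <= X](@tanh0 R) tanh_le// mulr_ge0_le0// mulr_le0_ge0 ?(ltW Vn0)//; lra.
by nra.
Qed.

(** The two total rates add up to at most [1 + 2 / N]. Counting shared moves once saves at least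
    half of the minima, that is [pmin / 4] at distance at most [n / 2], and this exceeds [2 / N]. *)
Lemma coupled_mass_le1 x y : dom x -> dom y -> (2 * count_dist x y <= n)%N ->
  8 / pmin <= N -> coupled_mass beta Nc n x y <= 1.
Proof.
move=> xd yd Dn bigN; have p0 := pmin_gt0.
have M : coupled_mass beta Nc n x y <= \sum_m rate x m + \sum_m rate y m -
    2^-1 * \sum_m Num.min (rate x m) (rate y m).
  rewrite mulr_sumr -big_split -sumrB; apply: ler_sum => m _ /=.
  rewrite /alone [common _ _ _ y x m]commonC /common.
  set w := Num.min _ _.
  have : 0 <= w by rewrite le_min !count_rate_ge0.
  by case: ifP => _; lra.
have S : pmin * (N - (count_dist x y)%:R) / N <= \sum_m Num.min (rate x m) (rate y m).
  have -> : N - (count_dist x y)%:R = \sum_c ((Nc c)%:R - ((x c - y c) + (y c - x c))%:R).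
    by rewrite sumrB (@sum_Nc R _ _ _ Ncn) /count_dist natr_sum.
  rewrite sum_moves mulr_sumr mulr_suml; apply: ler_sum => c _.
  exact: rate_min_ge.
have D' : 2 * (count_dist x y)%:R <= N by rewrite -natrM ler_nat.
have S2 : pmin / 2 <= pmin * (N - (count_dist x y)%:R) / N.
  by rewrite ler_pdivlMr//; nra.
have Mx := rate_total_le xd; have My := rate_total_le yd.
have : 2 * N^-1 <= pmin / 4.
  rewrite ler_pdivrMr// in bigN.
  by rewrite ler_pdivrMr//; lra.
by lra.
Qed.

(** Where the counts differ, each chain shares only half of the minimum, so the single moves carry
    at least the full rate of [x]: [pmin / 4] in a class of [n / 4] sites. As the drift is
    nonpositive, at least half of the single moves go toward. *)
Lemma toward_mass_ge x y : dom x -> dom y -> x != y ->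
  (forall c, n <= 4 * Nc c)%N -> pmin / 8 <= toward_mass beta Nc n x y.
Proof.
move=> xd yd xy Nc4; have p0 := pmin_gt0.
have [c xyc] : exists c, x c != y c.
  apply/existsP; apply: contraNT xy; rewrite negb_exists => /forallP H.
  by apply/eqP/ffunP => c; apply/eqP; have := H c; rewrite negbK.
have A m := alone_ge0 beta n m xd yd.
have A' m := alone_ge0 beta n m yd xd.
have S : pmin / 4 <= away_mass beta Nc n x y + toward_mass beta Nc n x y.
  rewrite -big_split /= (_ : \sum_m _ = \sum_m (alone beta Nc n x y m + alone beta Nc n y x m)).
    rewrite sum_moves (bigD1 c)//= -[leLHS]addr0 lerD//.
      have k b : rate x (c, b) <= alone beta Nc n x y (c, b) + alone beta Nc n y x (c, b).
        rewrite /alone [common _ _ _ y x _]commonC /common /= (negbTE xyc).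
        set w := Num.min _ _.
        have : w <= rate y (c, b) by rewrite ge_min lexx orbT.
        by lra.
      have := rate_sum_ge c xd; have := k true; have := k false.
      have : pmin / 4 <= pmin * (Nc c)%:R / N.
        have : N <= 4 * (Nc c)%:R by rewrite -natrM ler_nat.
        by rewrite ler_pdivlMr//; nra.
      by lra.
    by apply: sumr_ge0 => d _; apply: addr_ge0; apply: addr_ge0; [exact: A | exact: A' | exact: A | exact: A'].
  by apply: eq_bigr => m _; case: toward; case: toward => /=; ring.
have := coupling_drift beta01 n2 Ncn xd yd.
have : - (1 - beta) * (count_dist x y)%:R / N <= 0.
  have /andP[b0 b1] := beta01.
  by rewrite mulr_le0_ge0 ?(ltW Vn0)// mulr_le0_ge0//; lra.
by lra.
Qed.

End CountChainMass.

(** * Smoothing and contraction *)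

Section CountChainSmoothing.
Context {R : realType} (beta : R) {C : finType} (Nc : C -> nat) (n : nat).
Hypothesis beta01 : 0 <= beta < 1.
Hypothesis n2 : (1 < n)%N.
Hypothesis Ncn : (\sum_c Nc c = n)%N.
Hypothesis Nc4 : forall c, (n <= 4 * Nc c)%N.

Local Notation N := (n%:R : R).
Local Notation state := {ffun C -> nat}.
Local Notation pmin := ((1 - tanh 2) / 2 : R).
Local Notation dom := (count_dom Nc).
Local Notation Q := (@count_op R beta C Nc n).
Implicit Types (x y : state) (c : C) (b : bool) (m : C * bool).

Hypothesis bigN : 8 / pmin <= n%:R.

Let n0 : (0 < n)%N. Proof. exact: ltnW. Qed.
Let N0 : 0 < n%:R :> R. Proof. by rewrite ltr0n. Qed.
Let Nn0 : n%:R != 0 :> R. Proof. by rewrite gt_eqF. Qed.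
Let N2 : 2 <= n%:R :> R. Proof. by rewrite ler_nat. Qed.
Let Vn0 : 0 < n%:R^-1 :> R. Proof. by rewrite invr_gt0. Qed.

Lemma count_op_bounds (g : state -> R) (lo hi : R) :
  (forall x, dom x -> lo <= g x <= hi) ->
  forall x, dom x -> lo <= Q g x <= hi.
Proof.
move=> H x xd.
have S1 : \sum_m count_rate beta Nc n x m <= 1.
  apply: (le_trans (rate_total_le beta01 n2 Ncn xd)).
  have : N^-1 <= 2^-1 by rewrite lef_pV2 ?posrE.
  by lra.
have r0 m := count_rate_ge0 beta n m xd.
have K m : count_rate beta Nc n x m * lo <= count_rate beta Nc n x m * g (count_move x m)
   <= count_rate beta Nc n x m * hi.
  have [->|rn] := eqVneq (count_rate beta Nc n x m) 0; first by rewrite !mul0r lexx.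
  have /H/andP[a b] := genuine_dom xd (count_rate_genuine xd rn).
  by rewrite !ler_wpM2l.
have -> : Q g x = (1 - \sum_m count_rate beta Nc n x m) * g x +
    \sum_m count_rate beta Nc n x m * g (count_move x m).
  rewrite /count_op mulrBl mul1r -addrA; congr (_ + _).
  rewrite mulr_suml -sumrN -big_split; apply: eq_bigr => m _ /=; ring.
have /andP[a b] := H x xd.
have lo' : (\sum_m count_rate beta Nc n x m) * lo <=
    \sum_m count_rate beta Nc n x m * g (count_move x m).
  by rewrite mulr_suml; apply: ler_sum => m _; have /andP[] := K m.
have hi' : \sum_m count_rate beta Nc n x m * g (count_move x m) <=
    (\sum_m count_rate beta Nc n x m) * hi.
  by rewrite mulr_suml; apply: ler_sum => m _; have /andP[] := K m.
move: S1 lo' hi'; set S := \sum_m _ => S1 lo' hi'.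
by apply/andP; split; nra.
Qed.

Lemma count_op_scale (k : R) (g : state -> R) x : Q (fun y => k * g y) x = k * Q g x.
Proof.
rewrite /count_op mulrDr mulr_sumr; congr (_ + _).
by apply: eq_bigr => m _; ring.
Qed.

Lemma iter_count_op_bounds (g : state -> R) (lo hi : R) t :
  (forall x, dom x -> lo <= g x <= hi) ->
  forall x, dom x -> lo <= iter t Q g x <= hi.
Proof. by move=> H; elim: t => //= t IH; exact: count_op_bounds. Qed.

(** Path coupling: lowering a larger coordinate by one stays in the domain and shortens the
    distance, so neighbours suffice. *)
Lemma lipschitz_path (g : state -> R) (L : R) :
  (forall x y, dom x -> dom y -> count_dist x y = 1%N -> `|g x - g y| <= L) ->
  forall x y, dom x -> dom y -> `|g x - g y| <= L * (count_dist x y)%:R.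
Proof.
move=> H x y; move E : (count_dist x y) => d; elim: d x y E => [|d IH] x y E xd yd.
  move/eqP: E; rewrite count_dist_eq0 => /eqP ->.
  by rewrite subrr normr0 mulr0.
have self z : count_dist z z = 0%N by apply/eqP; rewrite count_dist_eq0.
have [c xyc] : exists c, x c != y c.
  apply/existsP; move: E; apply: contra_eqT; rewrite negb_exists => /forallP K.
  suff -> : x = y by rewrite self.
  by apply/ffunP => c; apply/eqP; have := K c; rewrite negbK.
have step z w : dom z -> dom w -> count_dist z w = d.+1 -> (w c < z c)%N ->
    `|g z - g w| <= L * d.+1%:R.
  move=> zd wd zw lt.
  have gz : genuine Nc z (c, false) by rewrite /genuine /=; lia.
  have zd' := genuine_dom zd gz.
  have E1 : count_dist z (count_move z (c, false)) = 1%N.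
    by rewrite count_distC (count_dist_move _ gz) self /toward /= ltnn.
  have E2 : count_dist (count_move z (c, false)) w = d.
    by rewrite (count_dist_move _ gz) /toward /= lt zw.
  rewrite -natr1 mulrDr mulr1 (le_trans (ler_distD (g (count_move z (c, false))) _ _))//.
  by rewrite addrC lerD// ?H// IH.
have [lt|lt|e] := ltngtP (x c) (y c); last by rewrite e eqxx in xyc.
  by rewrite distrC step// count_distC.
exact: step.
Qed.

(** Only neighbours need be compared, and [n >= 2] puts them within the range of
    [coupled_mass_le1]. *)
Lemma count_op_contract (g : state -> R) (L : R) :
  (forall x y, dom x -> dom y -> `|g x - g y| <= L * (count_dist x y)%:R) ->
  forall x y, dom x -> dom y ->
  `|Q g x - Q g y| <= (1 - (1 - beta) / N) * L * (count_dist x y)%:R.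
Proof.
move=> H; apply: lipschitz_path => x y xd yd D1.
have T1 : coupled_mass beta Nc n x y <= 1.
  by apply: coupled_mass_le1 => //; rewrite D1.
have := @count_op_coupling R beta C Nc n x y g (fun d => L * d%:R) xd yd T1 H.
have dr := coupling_drift beta01 n2 Ncn xd yd.
rewrite D1 mulr1 in dr *.
have L0 : 0 <= L.
  by have := H _ _ xd yd; rewrite D1 mulr1; apply: le_trans.
rewrite /= mulr0 mulr1 => /le_trans; apply.
have := ler_wpM2l L0 dr; nra.
Qed.

Lemma iter_count_op_contract (g : state -> R) (L : R) t :
  (forall x y, dom x -> dom y -> `|g x - g y| <= L * (count_dist x y)%:R) ->
  forall x y, dom x -> dom y ->
  `|iter t Q g x - iter t Q g y| <= (1 - (1 - beta) / N) ^+ t * L * (count_dist x y)%:R.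
Proof.
move=> H; elim: t => [|t IH]; first by rewrite expr0 mul1r.
by rewrite exprS -mulrA; exact: count_op_contract.
Qed.

(** Of order [n ^ (-1/2)], scaled so that the second-order gain [h ^+ 2 * pmin / 8] per step is
    [1 / n]. *)
Variable h : R.
Hypothesis h0 : 0 < h.
Hypothesis hE : h ^+ 2 * (pmin / 8) * N = 1.

Lemma bernoulli (x : R) k : 0 <= x -> 1 + k%:R * x <= (1 + x) ^+ k.
Proof.
move=> x0; elim: k => [|k IH]; first by rewrite mul0r addr0 expr0.
rewrite exprS -natr1; have : 0 <= k%:R * x by rewrite mulr_ge0.
by move: IH; set p := (1 + x) ^+ k => ? ?; nra.
Qed.

(* With [z = 1 - h], the coupling increases the expectation of [z ^+ D] by a
   factor [1 + 1 / n] per step until the chains meet, so that they have met by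
   time [t] with probability at least
   [(z ^+ D - (1 + 1 / n) ^- t) / (1 - (1 + 1 / n) ^- t)]. *)
Lemma smoothing (g : state -> R) t : (forall x, dom x -> 0 <= g x <= 1) ->
  (t <= n)%N -> forall x y, dom x -> dom y ->
  (1 - (1 + N^-1) ^- t) * `|iter t Q g x - iter t Q g y| <= 1 - (1 - h) ^+ count_dist x y.
Proof.
move=> g01; have p0 := pmin_gt0 (R := R).
have p1 : pmin <= 2^-1.
  have : tanh 0 <= tanh 2 :> R by exact: tanh_le.
  by rewrite tanh0; lra.
have N2' := N2; have h0' := h0.
have hN : 2 <= h * N.
  have : 4 <= (h * N) ^+ 2.
    have : (h * N) ^+ 2 * (pmin / 8) = N.
      by rewrite [LHS](_ : _ = h ^+ 2 * (pmin / 8) * N * N); [rewrite hE mul1r | ring].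
    have := sqr_ge0 (h * N); set q := (h * N) ^+ 2 => ? ?; nra.
  have : 0 <= h * N by rewrite mulr_ge0 ?ltW.
  by set q := h * N => ? ?; nra.
have h1 : h <= 1.
  have : 1 <= pmin / 8 * N by move: bigN; rewrite ler_pdivrMr//; lra.
  by move: hE; rewrite -mulrA; set q := _ * N => ? ?; nra.
have r1 : 1 < 1 + N^-1 by rewrite ltrDl.
have r0 : 0 < 1 + N^-1 by apply: lt_trans r1.
elim: t => [|t IH] tn x y xd yd.
  rewrite expr0 invr1 subrr mul0r subr_ge0 exprn_ile1 ?subr_ge0//.
  by rewrite gerBl ltW.
have q1 : `|iter t.+1 Q g x - iter t.+1 Q g y| <= 1.
  have /andP[a0 a1] := iter_count_op_bounds t.+1 g01 xd.
  have /andP[b0 b1] := iter_count_op_bounds t.+1 g01 yd.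
  by rewrite ler_norml; apply/andP; split; lra.
have [D0|D0] := posnP (count_dist x y).
  rewrite D0 expr0 subrr; move/eqP: D0; rewrite count_dist_eq0 => /eqP ->.
  by rewrite subrr normr0 mulr0.
set e := (1 - h) ^+ _.
have qe : (1 - (1 + N^-1) ^- t.+1) * `|iter t.+1 Q g x - iter t.+1 Q g y|
    <= 1 - (1 + N^-1) ^- t.+1.
  by rewrite ler_piMr// subr_ge0 invf_le1 ?exprn_gt0// exprn_ege1// ltW.
(* For [e] this small the trivial bound [q1] is enough. *)
have [|Dn] := leP e ((1 + N^-1) ^- t.+1).
  by move=> ew; apply: (le_trans qe); lra.
(* Since [t < n], [e] now exceeds [exp (-1)], whereas [h * N >= 2] would give [e <= exp (-1)] at a
   distance of [n / 2] or more. *)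
have D2n : (2 * count_dist x y <= n)%N.
  rewrite leqNgt; apply/negP => Dbig; move: Dn; apply/negP; rewrite -leNgt.
  apply: (@le_trans _ _ (expR (- 1))).
    apply: (@le_trans _ _ (expR (- h) ^+ count_dist x y)).
      by apply: lerXn2r; rewrite ?nnegrE ?expR_ge0 ?subr_ge0//; exact: expR_ge1Dx.
    rewrite -expRM_natr ler_expR.
    have : N <= 2 * (count_dist x y)%:R by rewrite -natrM ler_nat ltnW.
    by nra.
  rewrite expRN lef_pV2 ?posrE ?expR_gt0 ?exprn_gt0//.
  apply: (@le_trans _ _ (expR N^-1 ^+ t.+1)).
    by apply: lerXn2r; rewrite ?nnegrE ?expR_ge0 ?(ltW r0)//; exact: expR_ge1Dx.
  rewrite -expRM_natr ler_expR mulrC ler_pdivrMr// mul1r ler_nat//.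
have T1 := coupled_mass_le1 beta01 n2 Ncn xd yd D2n bigN.
pose g' := fun x => (1 - (1 + N^-1) ^- t) * iter t Q g x.
have w1 : 0 <= 1 - (1 + N^-1) ^- t.
  by rewrite subr_ge0 invf_le1 ?exprn_gt0// exprn_ege1// ltW.
have H x' y' : dom x' -> dom y' -> `|g' x' - g' y'| <= 1 - (1 - h) ^+ count_dist x' y'.
  by move=> xd' yd'; rewrite -mulrBr normrM ger0_norm// IH// ltnW.
have := @count_op_coupling R beta C Nc n x y g' (fun d => 1 - (1 - h) ^+ d) xd yd T1 H.
rewrite !count_op_scale -mulrBr normrM ger0_norm// -/(iter t.+1 Q g).
have dr := coupling_drift beta01 n2 Ncn xd yd.
have xy : x != y by rewrite -count_dist_eq0 -lt0n.
have tm := toward_mass_ge beta01 n2 Ncn xd yd xy Nc4.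
have mm : away_mass beta Nc n x y <= toward_mass beta Nc n x y.
  have /andP[b0 b1] := beta01.
  suff : - (1 - beta) * (count_dist x y)%:R / N <= 0 by lra.
  by rewrite mulr_le0_ge0 ?(ltW Vn0)// mulr_le0_ge0//; lra.
have eD : (1 - h) ^+ (count_dist x y) = (1 - h) * (1 - h) ^+ (count_dist x y).-1.
  by rewrite -exprS prednK.
rewrite -/e in eD.
have e0 : 0 <= (1 - h) ^+ (count_dist x y).-1 by rewrite exprn_ge0// subr_ge0.
set E := (1 - h) ^+ (count_dist x y).-1 in eD e0 *.
have hk : h ^+ 2 * (pmin / 8) = N^-1 by rewrite -[LHS](mulfK Nn0) hE mul1r.
set q := `|iter t.+1 Q g x - iter t.+1 Q g y| in q1 qe *.
set w := (1 + N^-1) ^- t in w1 *.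
have wS : (1 + N^-1) ^- t.+1 = w / (1 + N^-1) by rewrite exprS invfM mulrC.
rewrite wS in qe Dn *.
set A := away_mass _ _ _ _ _ in mm *; set T := toward_mass _ _ _ _ _ in mm tm *.
move=> main; rewrite -/e exprS -/e in main.
have main2 : (1 - w) * q <= 1 - (1 + N^-1) * e.
  apply: (le_trans main).
  (* As [A <= T] and [T >= pmin / 8], the bracket is at least [h * pmin / 8]: the fluctuations of
     the distance give the gain, even without drift. *)
  have -> : 1 - e + A * (1 - (1 - h) * e - (1 - e)) + T * (1 - E - (1 - e)) =
    1 - e - E * h * (T - (1 - h) * A) by rewrite eD; ring.
  suff : N^-1 * e <= E * h * (T - (1 - h) * A) by lra.
  rewrite -hk eD.
  have -> : h ^+ 2 * (pmin / 8) * ((1 - h) * E) = E * h * (h * (pmin / 8) * (1 - h)) by ring.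
  rewrite ler_wpM2l//; first by rewrite mulr_ge0// ltW.
  have : A * (1 - h) <= T * (1 - h) by rewrite ler_wpM2r// subr_ge0.
  have : h * (pmin / 8) <= h * T by rewrite ler_wpM2l// ltW.
  have hp : 0 <= h * (pmin / 8) by rewrite mulr_ge0 ?(ltW h0)//; lra.
  have : h * (pmin / 8) * (1 - h) <= h * (pmin / 8) by apply: ler_piMr => //; lra.
  by lra.
set r := 1 + N^-1 in r1 r0 main2 Dn qe wS *.
have wr : w = r * (w / r) by field; rewrite gt_eqF.
set u := w / r in wr Dn qe *; rewrite wr in main2.
have q0 : 0 <= q by exact: normr_ge0.
(* Write [(1 - u) q = (1 - r u) q + (r - 1) u q] and use [main2], [q <= 1] and [u <= e]. *)
have : (r - 1) * u <= (r - 1) * e by rewrite ler_wpM2l ?ltW// subr_gt0.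
have : u * (r - 1) * q <= u * (r - 1).
  by rewrite ler_piMr// mulr_ge0 ?subr_ge0 ?(ltW r1)// /u divr_ge0 ?(ltW r0)// invr_ge0 exprn_ge0// ltW.
by lra.
Qed.

(** For neighbours and [t = n] the right side of [smoothing] is [h], and [(1 + 1 / n) ^+ n >= 2]
    makes its prefactor at least [1/2]. *)
Lemma smoothing_lipschitz (g : state -> R) : (forall x, dom x -> 0 <= g x <= 1) ->
  forall x y, dom x -> dom y ->
  `|iter n Q g x - iter n Q g y| <= 2 * h * (count_dist x y)%:R.
Proof.
move=> g01; apply: lipschitz_path => x y xd yd D1.
have := smoothing g01 (leqnn n) xd yd; rewrite D1 expr1.
have r1 : 0 <= N^-1 by exact: ltW.
have : 2 <= (1 + N^-1) ^+ n.
  have := bernoulli n r1; rewrite mulfV//; lra.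
set w := (1 + N^-1) ^+ n => w2.
have w0 : 0 < w by apply: lt_le_trans w2.
have : w^-1 <= 2^-1 by rewrite lef_pV2 ?posrE.
set d := `|_| => wi; have : 0 <= d by exact: normr_ge0.
nra.
Qed.

End CountChainSmoothing.

(** * Upper bound *)

Section Lumping.
Context {R : realType} (beta : R) (n : nat) (s0 : config n).
Hypothesis n0 : (0 < n)%N.

Local Notation mag := (@magnetization R n).
Local Notation N := (n%:R : R).
Local Notation P := (@markov_op R _ (@glauber R beta n)).
Implicit Types (s : config n) (i : 'I_n) (c b : bool).

Let Nn0 : n%:R != 0 :> R. Proof. by rewrite pnatr_eq0 -lt0n. Qed.

(* Two classes: the sites where [s0] is [+] and those where it is [-]. *)
Definition class_size c : nat := \sum_(i | s0 i == c) 1.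

Definition class_count s : {ffun bool -> nat} :=
  [ffun c => (\sum_(i | s0 i == c) s i)%N].

Local Notation Q := (@count_op R beta bool class_size n).

Lemma class_size_sum : (\sum_c class_size c = n)%N.
Proof.
transitivity (\sum_(i < n) 1)%N; last by rewrite sum1_card card_ord.
by rewrite (partition_big s0 xpredT).
Qed.

Lemma class_count_dom s : count_dom class_size (class_count s).
Proof. by move=> c; rewrite ffunE leq_sum// => i _; case: (s i). Qed.

Lemma total_class_count s : total (class_count s) = (\sum_i s i)%N.
Proof.
rewrite /total (partition_big s0 xpredT)//=.
by apply: eq_bigr => c _; rewrite ffunE.
Qed.

Lemma magnetization_count s : mag s = (2 * (total (class_count s))%:R - N) / N.
Proof.
rewrite total_class_count /magnetization mulrC; congr (_ / _).
have -> : N = \sum_(i < n) 1 by rewrite sumr_const card_ord.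
rewrite natr_sum mulr_sumr -sumrB; apply: eq_bigr => i _.
by rewrite /spin; case: (s i); rewrite ?mulr1 ?mulr0 ?sub0r//=; lra.
Qed.

Lemma class_count_flip s i :
  class_count (flip s i) = count_move (class_count s) (s0 i, ~~ s i).
Proof.
apply/ffunP => c; rewrite !ffunE /=.
have e d : (\sum_(j | s0 j == d) flip s i j)%N =
    ((s0 i == d) * ~~ s i + \sum_(j | (s0 j == d) && (j != i)) s j)%N.
  have [e|ne] := eqVneq (s0 i) d.
    rewrite (bigD1 i) ?e ?eqxx//= ffunE eqxx mul1n; congr (_ + _)%N.
    by apply: eq_bigr => j /andP[_ ji]; rewrite ffunE (negbTE ji).
  rewrite mul0n add0n; apply: eq_big => [j|j /eqP sj].
    by case: eqP => // sj; case: eqP => // ji; rewrite -sj ji eqxx in ne.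
  rewrite ffunE; case: eqP => // ji; rewrite -sj ji eqxx in ne; done.
have e' d : (\sum_(j | s0 j == d) s j)%N =
    ((s0 i == d) * s i + \sum_(j | (s0 j == d) && (j != i)) s j)%N.
  have [e1|ne] := eqVneq (s0 i) d.
    by rewrite (bigD1 i) ?e1 ?eqxx//= mul1n.
  rewrite mul0n add0n; apply: eq_bigl => j.
  by case: eqP => // sj; case: eqP => // ji; rewrite -sj ji eqxx in ne.
rewrite e e' [c == _]eq_sym; case: eqP => _; last by rewrite !mul0n.
by case: (s i); rewrite /= !(muln0, muln1, add0n, add1n).
Qed.

Lemma flip_rate_count s i : flip_rate beta s i =
  N^-1 * (if ~~ s i then p_up beta n (class_count s)
          else 1 - p_down beta n (class_count s)).
Proof.
rewrite /flip_rate /cavity magnetization_count /p_up /p_down /spin.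
case: (s i) => /=; congr (_ * _).
  by congr (1 - p_plus _ _); ring.
by congr (p_plus _ _); ring.
Qed.

(** Lumpability: sites of one class with one spin value flip at equal rates, and the counts
    determine their number. *)
Lemma glauber_op_count (g : {ffun bool -> nat} -> R) s :
  P (fun s => g (class_count s)) s = Q g (class_count s).
Proof.
rewrite glauber_opE// /count_op; congr (_ + _).
set x := class_count s.
pose F (m : bool * bool) : R := N^-1 * (if m.2 then p_up beta n x else 1 - p_down beta n x) *
   (g (count_move x m) - g x).
transitivity (\sum_i F (s0 i, ~~ s i)).
  by apply: eq_bigr => i _; rewrite flip_rate_count class_count_flip.
rewrite (partition_big (fun i => (s0 i, ~~ s i)) xpredT)//=.
apply: eq_bigr => -[c b] _.
transitivity (\sum_(i | (s0 i == c) && (~~ s i == b)) F (c, b)).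
  by apply: eq_big => [i|i /eqP -> //]; rewrite xpair_eqE.
rewrite sumr_const -[_ *+ _]mulr_natl /F /count_rate /=.
have E : (#|[pred i | (s0 i == c) && (~~ s i == b)]|%:R : R) =
   if b then (class_size c)%:R - (x c)%:R else (x c)%:R.
  rewrite -sum1_card big_mkcondr /class_size ffunE /= !natr_sum -?sumrB.
  case: b => /=; rewrite -?sumrB; apply: eq_bigr => i _;
    by case: (s i); rewrite /= ?subrr ?subr0.
by rewrite E {E}; case: b => /=; ring.
Qed.

Lemma iter_glauber_count t (g : {ffun bool -> nat} -> R) s :
  iter t P (fun s => g (class_count s)) s = iter t Q g (class_count s).
Proof.
elim: t s => //= t IH s; rewrite -glauber_op_count.
by rewrite /markov_op; apply: eq_bigr => y _; rewrite IH.
Qed.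

(** The counts of [s0] are extreme, all [+] in one class and none in the other, so they determine
    the configuration. The initial law is thus a function of the counts. *)
Lemma class_count_inj s : (class_count s == class_count s0) = (s0 == s).
Proof.
apply/eqP/eqP => [H|-> //]; apply/ffunP => i.
have := congr1 (fun f : {ffun bool -> nat} => f (s0 i)) H; rewrite !ffunE.
rewrite (bigD1 i)//= [RHS](bigD1 i)//=.
have e : (\sum_(j | (s0 j == s0 i) && (j != i)) s0 j =
   s0 i * \sum_(j | (s0 j == s0 i) && (j != i)) 1)%N.
  by rewrite big_distrr; apply: eq_bigr => j /andP[/eqP -> _] /=; lia.
have le : (\sum_(j | (s0 j == s0 i) && (j != i)) s j <=
   \sum_(j | (s0 j == s0 i) && (j != i)) 1)%N.
  by apply: leq_sum => j _; case: (s j).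
rewrite e; move: le; set S := (\sum_(j | _) s j)%N; set T := (\sum_(j | _) 1)%N.
by case: (s0 i); case: (s i) => //=; lia.
Qed.

(* By reversibility the density of the law at time [t] with respect to [ising]
   is a function of the counts, hence so is the event realizing the distance. *)
Lemma tv_dist_count t (K : R) :
  (forall g : {ffun bool -> nat} -> R, (forall x, 0 <= g x <= 1) ->
   forall s, `|iter t Q g (class_count s0) - iter t Q g (class_count s)| <= K) ->
  tv_dist (law (glauber beta) s0 t) (ising beta) <= K.
Proof.
move=> HK.
have mu0 s := ising_gt0 beta s.
pose g0 x : R := (x == class_count s0)%:R / ising beta s0.
have lawE y : law (glauber beta) s0 t y = ising beta y * iter t Q g0 (class_count y).
  rewrite (@reversible_density _ _ _ (ising beta)); first last.
  - by move=> x z; exact: glauber_reversible.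
  - by move=> x; rewrite gt_eqF.
  congr (_ * _); rewrite -iter_glauber_count.
  have -> // : (fun z => (s0 == z)%:R / ising beta s0) = (fun s => g0 (class_count s)).
  by apply/funext => z; rewrite /g0 class_count_inj.
(* Indicator of the event that carries the positive part of the difference. *)
pose g x : R := (1 <= iter t Q g0 x)%R%:R.
apply: (le_trans (tv_dist_pos (law_prob beta s0 t n0) (@ising_prob R beta n))).
have -> : \sum_y (law (glauber beta) s0 t y - ising beta y) *
    (0 <= law (glauber beta) s0 t y - ising beta y)%R%:R =
    \sum_y (law (glauber beta) s0 t y - ising beta y) * g (class_count y).
  apply: eq_bigr => y _; rewrite /g.
  have -> : law (glauber beta) s0 t y - ising beta y =
      ising beta y * (iter t Q g0 (class_count y) - 1) by rewrite lawE; ring.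
  by rewrite pmulr_rge0// subr_ge0.
under eq_bigr do rewrite mulrBl.
rewrite sumrB (law_expect _ _ _ (fun y => g (class_count y))) iter_glauber_count.
(* By stationarity the equilibrium average is an average of iterates over starting points, so it
   remains to compare two starts. *)
rewrite -(ising_stationary beta n0 (fun y => g (class_count y)) t).
have [m0 m1] := @ising_prob R beta n.
set A := iter t Q g (class_count s0).
have -> : A = \sum_(y : config n) ising beta y * A by rewrite -mulr_suml m1 mul1r.
have -> : K = \sum_(y : config n) ising beta y * K by rewrite -mulr_suml m1 mul1r.
rewrite -sumrB; apply: ler_sum => y _; rewrite -mulrBr ler_wpM2l// iter_glauber_count.
apply: le_trans (ler_norm _) _; apply: HK => x.
by rewrite /g; case: (1 <= _)%R; rewrite ?lexx ?ler01.
Qed.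

End Lumping.

(** * Distance to equilibrium from balanced and from arbitrary states *)

Section UpperBound.
Context {R : realType} (beta : R) (n : nat).
Hypothesis beta01 : 0 <= beta < 1.
Hypothesis n2 : (1 < n)%N.
Implicit Types (s : config n).

Local Notation mag := (@magnetization R n).
Local Notation N := (n%:R : R).
Local Notation rho := (1 - (1 - beta) / N).
Local Notation pmin := ((1 - tanh 2) / 2 : R).

Hypothesis bigN : 8 / pmin <= n%:R.

Let n0 : (0 < n)%N. Proof. exact: ltnW. Qed.
Let N0 : 0 < n%:R :> R. Proof. by rewrite ltr0n. Qed.
Let Nn0 : n%:R != 0 :> R. Proof. by rewrite gt_eqF. Qed.

Lemma class_size_ge s : `|mag s| <= 2^-1 -> forall c, (n <= 4 * class_size s c)%N.
Proof.
move=> ms.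
have tE : total (class_count s s) = class_size s true.
  rewrite total_class_count /class_size [RHS]big_mkcond /=.
  by apply: eq_bigr => i _; case: (s i).
have S := class_size_sum s; rewrite big_bool /= in S.
move: ms; rewrite (magnetization_count s s) tE normrM [`|N^-1|]ger0_norm ?invr_ge0//.
rewrite ler_pdivrMr// ler_norml => /andP[].
have SR : (class_size s true)%:R + (class_size s false)%:R = n%:R :> R.
  by rewrite -natrD S.
move=> h1 h2 c; rewrite -(ler_nat R) natrM.
by case: c; lra.
Qed.

(** The innermost [n] iterations make the test function [2h]-Lipschitz, the outer [t] contract the
    constant; the distance is at most [n] and [h * N] is of order [sqrt N]. *)
Lemma tv_dist_good s t : `|mag s| <= 2^-1 ->
  tv_dist (law (glauber beta) s (t + n)) (ising beta) <=
  2 * Num.sqrt (8 / pmin) * Num.sqrt N * rho ^+ t.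
Proof.
move=> ms; have Nc4 := class_size_ge ms.
have p0 := pmin_gt0 (R := R).
have q0 : 0 < 8 / pmin by rewrite divr_gt0.
pose h : R := Num.sqrt (8 / pmin) / Num.sqrt N.
have sN : 0 < Num.sqrt N by rewrite sqrtr_gt0.
have h0 : 0 < h by rewrite divr_gt0// sqrtr_gt0.
have hE : h ^+ 2 * (pmin / 8) * N = 1.
  rewrite exprMn exprVn !sqr_sqrtr ?ltW//; field.
  by rewrite Nn0 gt_eqF//; move: p0; lra.
apply: tv_dist_count => // g g01 s'; rewrite iterD.
have Ncn := class_size_sum s.
have L1 := smoothing_lipschitz beta01 n2 Ncn Nc4 bigN h0 hE (fun x _ => g01 x).
apply: (le_trans (iter_count_op_contract beta01 n2 Ncn bigN t L1 _ _)).
- exact: class_count_dom.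
- exact: class_count_dom.
have Dn : (count_dist (class_count s s) (class_count s s') <= n)%N.
  rewrite -[leqRHS]Ncn; apply: leq_sum => c _.
  by move: (class_count_dom s s c) (class_count_dom s s' c); clear; lia.
have /andP[r0 r1] := rho_bound beta01 n2.
have rt : 0 <= rho ^+ t.
  by rewrite exprn_ge0//; apply: le_trans r0; rewrite invr_ge0.
rewrite (_ : 2 * Num.sqrt (8 / pmin) * Num.sqrt N * rho ^+ t = rho ^+ t * (2 * h) * N).
  by rewrite ler_wpM2l ?ler_nat// mulr_ge0// mulr_ge0// ltW.
have -> : N = Num.sqrt N ^+ 2 by rewrite sqr_sqrtr// ltW.
by rewrite /h sqrtr_sqr ger0_norm ?(ltW sN)//; field; rewrite gt_eqF.
Qed.

(** Markov property at time [t0], with the trivial bound [1] for the states in [A]. *)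
Lemma tv_dist_burn_in s t0 t (A : {set config n}) (K : R) : 0 <= K ->
  (forall z, z \notin A -> tv_dist (law (glauber beta) z t) (ising beta) <= K) ->
  tv_dist (law (glauber beta) s (t0 + t)) (ising beta) <=
  \sum_(z in A) law (glauber beta) s t0 z + K.
Proof.
move=> K0 HK; have [l0 l1] := law_prob beta s t0 n0.
apply: tv_dist_le => [|B]; first by rewrite addr_ge0// sumr_ge0.
have mk (D : {set config n}) (mu : config n -> R) : \sum_(x in D) mu x = \sum_x mu x * (x \in D)%:R.
  by rewrite big_mkcond; apply: eq_bigr => x _; case: (x \in D); rewrite ?mulr1 ?mulr0.
rewrite (mk B) law_expect iterD -law_expect.
have [m0 m1] := @ising_prob R beta n.
rewrite [X in _ - X](_ : _ = \sum_z law (glauber beta) s t0 z * \sum_(x in B) ising beta x);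
  last by rewrite -mulr_suml l1 mul1r.
rewrite -sumrB.
apply: (le_trans (ler_norm_sum _ _ _)).
apply: (@le_trans _ _ (\sum_z (law (glauber beta) s t0 z * (z \in A)%:R + law (glauber beta) s t0 z * K))).
  apply: ler_sum => z _; rewrite -mulrBr normrM ger0_norm// -mulrDr ler_wpM2l//.
  rewrite -law_expect /= -(mk B).
  have B1 := tv_dist_ge (law (glauber beta) z t) (ising beta) B.
  apply: (le_trans B1).
  have [zA|zA] := boolP (z \in A); last by rewrite add0r HK.
  have := tv_dist_le1 (law_prob beta z t n0) (@ising_prob R beta n).
  by rewrite /=; lra.
by rewrite big_split /= -mulr_suml l1 mul1r -(mk A).
Qed.

Lemma ising_dist_le t0 t :
  ising_dist beta n (t0 + (t + n)) <=
  4 * (rho ^+ (2 * t0) + 6 / (1 - beta) / N) +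
  2 * Num.sqrt (8 / pmin) * Num.sqrt N * rho ^+ t.
Proof.
have /andP[r0 r1] := rho_bound beta01 n2.
have r00 : 0 <= rho by apply: le_trans r0; rewrite invr_ge0.
have K0 : 0 <= 2 * Num.sqrt (8 / pmin) * Num.sqrt N * rho ^+ t.
  by rewrite !mulr_ge0 ?sqrtr_ge0 ?exprn_ge0.
have gap0 : 0 < 1 - beta by have /andP[] := beta01; lra.
have b0 : 0 <= 4 * (rho ^+ (2 * t0) + 6 / (1 - beta) / N).
  by rewrite mulr_ge0// addr_ge0 ?exprn_ge0// divr_ge0// divr_ge0// ltW.
apply: bigmax_le => [|s _]; first exact: addr_ge0.
pose A : {set config n} := [set y | 2^-1 < `|mag y|]%SET.
apply: (le_trans (@tv_dist_burn_in s t0 (t + n) A _ K0 _)).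
  by move=> z; rewrite inE -leNgt => zs; exact: tv_dist_good.
rewrite lerD2r; have := magnetization_large_prob beta01 n2 t0 s.
by rewrite ler_pdivrMl//.
Qed.

End UpperBound.

(** * Cutoff *)

Section LimitsInferiorSuperior.
Context {R : realType}.

Lemma limn_einf_bounds (u : nat -> R) (a b : R) :
  (\forall n \near \oo, a <= u n <= b) ->
  (a%:E <= limn_einf (fun n => (u n)%:E) <= b%:E)%E.
Proof.
move=> [M _ HM]; apply/andP; split.
  rewrite limn_einf_lim; apply: lime_ge; first exact: is_cvg_einfs.
  exists M => // m /= Mm; apply: le_ereal_inf_tmp => _ [k /= mk <-].
  by rewrite lee_fin; have /andP[] := HM k (leq_trans Mm mk).
apply: (le_trans (limn_einf_sup _)).
rewrite limn_esup_lim; apply: lime_le; first exact: is_cvg_esups.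
exists M => // m /= Mm; apply: ge_ereal_sup => _ [k /= mk <-].
by rewrite lee_fin; have /andP[] := HM k (leq_trans Mm mk).
Qed.

Lemma limn_esup_bounds (u : nat -> R) (a b : R) :
  (\forall n \near \oo, a <= u n <= b) ->
  (a%:E <= limn_esup (fun n => (u n)%:E) <= b%:E)%E.
Proof.
move=> [M _ HM]; apply/andP; split.
  apply: le_trans (limn_einf_sup _).
  by have /andP[] := limn_einf_bounds (ex_intro2 _ _ M I HM).
rewrite limn_esup_lim; apply: lime_le; first exact: is_cvg_esups.
exists M => // m /= Mm; apply: ge_ereal_sup => _ [k /= mk <-].
by rewrite lee_fin; have /andP[] := HM k (leq_trans Mm mk).
Qed.

Lemma cvge_pinfty_bounds (F : R -> \bar R) (a : R) :
  (forall e : R, 0 < e -> exists g0 : R, forall g, g0 <= g ->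
    ((a - e)%:E <= F g <= (a + e)%:E)%E) ->
  F g @[g --> +oo%R] --> a%:E.
Proof.
move=> H; apply/fine_cvgP; split.
  have [g0 Hg] := H 1 ltr01.
  apply: filterS (nbhs_pinfty_ge (num_real g0)) => g /Hg /andP[h1 h2].
  by rewrite fin_numE; apply/andP; split; apply/eqP => E; rewrite E in h1 h2.
apply/cvgrPdist_le => e e0; have [g0 Hg] := H e e0.
apply: filterS (nbhs_pinfty_ge (num_real g0)) => g /Hg.
rewrite /=; case: (F g) => [x||] /andP[] /=; rewrite ?lee_fin ?leye_eq ?leeNy_eq// => h1 h2.
by rewrite ler_distl; apply/andP; split; lra.
Qed.

End LimitsInferiorSuperior.

(** * Initial states and asymptotics of the contraction factor *)

Section Asymptotics.
Context {R : realType} (beta : R).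
Hypothesis beta01 : 0 <= beta < 1.

Local Notation q := (1 - beta).
Local Notation tn n := ((2 * (1 - beta))^-1 * n%:R * ln n%:R : R).

Lemma near_natr_ge (M : R) : \forall n \near \oo, M <= n%:R :> R.
Proof.
near=> n; apply: (@le_trans _ _ (Num.bound `|M|)%:R); last first.
  by rewrite ler_nat; near: n; exact: nbhs_infty_ge.
apply: (le_trans (ler_norm M)).
by rewrite ltW// archi_boundP.
Unshelve. all: by end_near. Qed.

Lemma ising_dist_bounds (n t : nat) : (0 < n)%N -> 0 <= ising_dist beta n t <= 1.
Proof.
move=> n0; rewrite bigmax_ge_id/=; apply: bigmax_le => // s _.
exact: tv_dist_le1 (law_prob beta s t n0) (@ising_prob R beta n).
Qed.

Lemma exists_config (n : nat) (x : R) : (0 < n)%N -> 0 <= x <= 1 ->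
  exists s : config n, x - 2 / n%:R <= magnetization s <= x.
Proof.
move=> n0 /andP[x0 x1]; have N0 : 0 < n%:R :> R by rewrite ltr0n.
(* With exactly [y] spins [+] the magnetization would be [x]; rounding down lowers it by at most
   [2 / n]. *)
pose y := n%:R * (1 + x) / 2.
have y0 : 0 <= y by rewrite divr_ge0// mulr_ge0//; lra.
have /andP[k0 k1] := truncn_itv y0; set k := Num.truncn y in k0 k1.
have kn : (k <= n)%N by rewrite -(ler_nat R) (le_trans k0)// /y; nra.
exists [ffun i : 'I_n => (i < k)%N].
have -> : magnetization [ffun i : 'I_n => (i < k)%N] = (2 * k%:R - n%:R) / n%:R :> R.
  rewrite /magnetization mulrC; congr (_ / _).
  rewrite (eq_bigr (fun i : 'I_n => 2 * ((i < k)%N)%:R - 1)); last first.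
    by move=> i _; rewrite /spin ffunE; case: ifP => _; rewrite ?mulr1 ?mulr0; lra.
  rewrite sumrB -mulr_sumr sumr_const card_ord; congr (2 * _ - _).
  rewrite -natr_sum; congr (_%:R).
  transitivity (\sum_(i < n | (i < k)%N) 1)%N.
    by rewrite [RHS]big_mkcond; apply: eq_bigr => i _; case: ifP.
  by rewrite -(big_ord_widen n (fun=> 1%N) kn) sum1_card card_ord.
rewrite -natr1 in k1.
rewrite ler_pdivrMr// -[leLHS](mulfK (lt0r_neq0 N0)) ler_pM2r ?invr_gt0//.
have -> : (x - 2 / n%:R) * n%:R = x * n%:R - 2 by field; rewrite lt0r_neq0.
by rewrite /y in k0 k1; apply/andP; split; lra.
Qed.

Lemma rho_exp_le (n t : nat) : (1 < n)%N ->
  (1 - q / n%:R) ^+ t <= expR (- (q * t%:R / n%:R)).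
Proof.
move=> n2; have /andP[r0 _] := rho_bound beta01 n2.
rewrite (_ : - (q * t%:R / n%:R) = - (q / n%:R) * t%:R); last by ring.
rewrite expRM_natr; apply: lerXn2r; rewrite ?nnegrE ?expR_ge0 ?expR_ge1Dx//.
by apply: le_trans r0; rewrite invr_ge0.
Qed.

(* From [1 / (1 - x) = 1 + x / (1 - x) <= exp (x / (1 - x))]. *)
Lemma rho_exp_ge (n t : nat) : (1 < n)%N ->
  expR (- (q * t%:R / (n%:R - q))) <= (1 - q / n%:R) ^+ t.
Proof.
move=> n2; have /andP[b0 b1] := beta01.
have N2 : 2 <= n%:R :> R by rewrite ler_nat.
have Nq : 0 < n%:R - q by lra.
have N0 : 0 < n%:R :> R by lra.
rewrite (_ : - (q * t%:R / (n%:R - q)) = - (q / (n%:R - q)) * t%:R); last by ring.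
rewrite expRM_natr expRN; apply: lerXn2r; rewrite ?nnegrE ?invr_ge0 ?expR_ge0//.
  by rewrite subr_ge0 ler_pdivrMr//; lra.
have rE : 1 - q / n%:R = (1 + q / (n%:R - q))^-1.
  by field; rewrite !gt_eqF//; lra.
rewrite rE lef_pV2 ?posrE ?expR_gt0 ?expR_ge1Dx//.
by rewrite addr_gt0// divr_gt0//; lra.
Qed.

Lemma rho_lower (n t : nat) (g : R) : (1 < n)%N -> 0 <= g ->
  t%:R <= tn n - g * n%:R ->
  expR (2 * q * g - 1) <= n%:R * (1 - q / n%:R) ^+ (2 * t).
Proof.
move=> n2 g0 tle; have /andP[b0 b1] := beta01.
have N2 : 2 <= n%:R :> R by rewrite ler_nat.
have Nq : 0 < n%:R - q by lra.
have N0 : 0 < n%:R :> R by lra.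
have lnN : ln n%:R <= n%:R - 1 :> R.
  have := @le_ln1Dx R (n%:R - 1); rewrite (_ : 1 + (n%:R - 1) = n%:R); last by ring.
  by apply; lra.
have ln0 : 0 <= ln n%:R :> R by rewrite ln_ge0// ler1n ltnW.
rewrite -{1}[n%:R](@lnK R) ?posrE//.
apply: (@le_trans _ _ (expR (ln n%:R) * expR (- (q * (2 * t)%:R / (n%:R - q))))); last first.
  by rewrite ler_pM2l ?expR_gt0// rho_exp_ge.
rewrite -expRD ler_expR natrM.
have -> : q * (2 * t%:R) / (n%:R - q) = 2 * q * t%:R / (n%:R - q) by ring.
suff : 2 * q * t%:R / (n%:R - q) <= ln n%:R - 2 * q * g + 1 by lra.
rewrite ler_pdivrMr//.
have : 2 * q * t%:R <= n%:R * ln n%:R - 2 * q * g * n%:R.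
  have q0 : 0 < 2 * q by lra.
  have := ler_wpM2l (ltW q0) tle.
  rewrite (_ : 2 * q * (tn n - g * n%:R) = n%:R * ln n%:R - 2 * q * g * n%:R)//.
  by field; rewrite gt_eqF//; lra.
have : 0 <= 2 * q * g * q by rewrite !mulr_ge0//; lra.
(* Dividing by [n - q] instead of [n] costs [q ln n / (n - q) <= 1], the source of the [- 1] in the
   exponent. *)
have : q * ln n%:R <= n%:R - q.
  have : q * ln n%:R <= 1 * (n%:R - 1) by apply: ler_pM => //; lra.
  lra.
lra.
Qed.

(** At [t = tn n] the exponent [q t / n] equals [ln n / 2], which cancels [sqrt n] exactly. *)
Lemma rho_upper (n t : nat) (g : R) : (1 < n)%N ->
  tn n + g * n%:R <= t%:R ->
  Num.sqrt n%:R * (1 - q / n%:R) ^+ t <= expR (- (q * g)).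
Proof.
move=> n2 tge; have /andP[b0 b1] := beta01.
have N2 : 2 <= n%:R :> R by rewrite ler_nat.
have N0 : 0 < n%:R :> R by lra.
have q0 : 0 < q by lra.
have -> : Num.sqrt n%:R = expR (ln n%:R / 2) :> R.
  have e : n%:R = expR (ln n%:R / 2) ^+ 2 :> R.
    by rewrite -expRM_natr divfK ?lnK ?posrE// gt_eqF.
  by rewrite [in LHS]e sqrtr_sqr ger0_norm// expR_ge0.
apply: (@le_trans _ _ (expR (ln n%:R / 2) * expR (- (q * t%:R / n%:R)))).
  by rewrite ler_pM2l ?expR_gt0// rho_exp_le.
rewrite -expRD ler_expR.
suff : ln n%:R / 2 + q * g <= q * t%:R / n%:R by lra.
rewrite ler_pdivlMr//.
have := ler_wpM2l (ltW q0) tge.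
rewrite (_ : q * (tn n + g * n%:R) = (ln n%:R / 2 + q * g) * n%:R)//.
by field; rewrite gt_eqF.
Qed.

End Asymptotics.

(** * The two sides of the cutoff *)

Section Cutoff.
Context {R : realType} (beta : R).
Hypothesis beta01 : 0 <= beta < 1.

Local Notation q := (1 - beta).
Local Notation tn n := ((2 * (1 - beta))^-1 * n%:R * ln n%:R : R).

Lemma window_littleo :
  (fun n : nat => n%:R : R) =o_\oo (fun n : nat => tn n).
Proof.
have q0 : 0 < q by have /andP[] := beta01; lra.
apply/eqoP => e e0; near=> n.
have n1 : 1 <= n%:R :> R by near: n; exact: near_natr_ge.
have nE : expR (2 * q / e) <= n%:R by near: n; exact: near_natr_ge.
have N0 : 0 < n%:R :> R by lra.
have ln_n : 2 * q / e <= ln n%:R by rewrite -(expRK (2 * q / e)) ler_ln ?posrE ?expR_gt0.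
have ln0 : 0 <= ln n%:R :> R by exact: ln_ge0.
have t0 : 0 <= tn n by rewrite mulr_ge0// mulr_ge0// invr_ge0; lra.
rewrite !ger0_norm//.
rewrite ler_pdivrMr// in ln_n.
have -> : e * tn n = n%:R * (ln n%:R * e / (2 * q)) by field; rewrite gt_eqF.
by rewrite -[leLHS]mulr1 ler_pM2l// ler_pdivlMr ?mul1r//; lra.
Unshelve. all: by end_near. Qed.

Lemma ising_dist_before (e : R) : 0 < e -> exists g0 : R, forall g, g0 <= g ->
  \forall n \near \oo, 1 - e <= ising_dist beta n (Num.truncn (tn n - g * n%:R)) <= 1.
Proof.
move=> e0; have /andP[b0 b1] := beta01.
have q0 : 0 < q by lra.
(* The factor [96] makes the term [48 / q * mag s] of [ising_dist_ge] at most [e / 2]. *)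
pose s1 := Num.min 1 (e * q / 96).
have s10 : 0 < s1 by rewrite lt_min ltr01/= divr_gt0// mulr_gt0.
have s11 : s1 <= 1 by rewrite ge_min lexx.
have s1e : s1 <= e * q / 96 by rewrite ge_min lexx orbT.
pose K := 48 / q + 8 * (3 * (6 / q + 1) / q).
have K0 : 0 < K.
  have p : 0 < 6 / q by rewrite divr_gt0.
  by rewrite addr_gt0 ?divr_gt0// mulr_gt0// divr_gt0// mulr_gt0// addr_gt0.
(* Solves [K <= e / 2 * (2 q g * (s1 ^+ 2 / 4))] for [g]: here [2 q g <= exp (2 q g - 1)] bounds the
   quantity in [rho_lower], and [s1 / 2] the magnetization, from below. *)
exists (4 * K / (q * e * s1 ^+ 2)) => g gE.
have g0 : 0 <= g.
  by apply: le_trans gE; rewrite divr_ge0 ?mulr_ge0 ?sqr_ge0// ltW.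
near=> n.
have N2 : 2 <= n%:R :> R by near: n; exact: near_natr_ge.
have Ns : 4 / s1 <= n%:R by near: n; exact: near_natr_ge.
have nE : expR (2 * q * g) <= n%:R by near: n; exact: near_natr_ge.
have n2 : (1 < n)%N by rewrite -(ltr_nat R); lra.
have n0 : (0 < n)%N by exact: ltnW.
have N0 : 0 < n%:R :> R by lra.
have ln_n : 2 * q * g <= ln n%:R by rewrite -(expRK (2 * q * g)) ler_ln ?posrE ?expR_gt0.
have tg0 : 0 <= tn n - g * n%:R.
  rewrite (_ : tn n - g * n%:R = (ln n%:R - 2 * q * g) * n%:R / (2 * q)).
    by rewrite divr_ge0 ?mulr_ge0 ?subr_ge0//; lra.
  by field; rewrite gt_eqF.
set t := Num.truncn _.
have /andP[_ ->] := ising_dist_bounds beta t n0; rewrite andbT.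
have tle : t%:R <= tn n - g * n%:R by have /andP[] := truncn_itv tg0.
have s01 : 0 <= s1 <= 1 by rewrite s11 ltW.
have [s /andP[sl su]] := exists_config n0 s01.
have sl' : s1 / 2 <= magnetization s.
  have : 2 / n%:R <= s1 / 2.
    rewrite ler_pdivrMr// in Ns.
    by rewrite ler_pdivrMr//; clear -Ns; lra.
  by clear -sl; lra.
have m0 : 0 < magnetization s :> R by apply: lt_le_trans sl'; rewrite divr_gt0.
apply: le_trans (ising_dist_ge beta01 n2 t m0).
have L := rho_lower beta01 n2 g0 tle.
have A : 48 / q * magnetization s <= e / 2.
  have -> : e / 2 = 48 / q * (e * q / 96) by field; rewrite gt_eqF.
  by rewrite ler_pM2l ?divr_gt0// (le_trans su).
suff : K / (n%:R * ((1 - q / n%:R) ^+ t * magnetization s) ^+ 2) <= e / 2 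
  by rewrite -/K; move: A; set a := 48 / q * _; set w := K / _; clear; lra.
set r := (1 - q / n%:R) in L *.
have X0 : 0 < expR (2 * q * g - 1) by exact: expR_gt0.
have XL : 2 * q * g <= expR (2 * q * g - 1).
  by have := expR_ge1Dx (2 * q * g - 1); clear; lra.
rewrite exprMn mulrA -exprM [(t * 2)%N]mulnC.
set Y := n%:R * r ^+ (2 * t) in L *; set X := expR _ in L X0 XL.
have Y0 : 0 < Y by apply: lt_le_trans L.
rewrite ler_pdivrMr; last by rewrite mulr_gt0// exprn_gt0.
rewrite ler_pdivrMr ?mulr_gt0 ?exprn_gt0// in gE.
have mm : s1 ^+ 2 / 4 <= magnetization s ^+ 2 by clear -sl' s10; nra.
have YY : 2 * q * g * (s1 ^+ 2 / 4) <= Y * magnetization s ^+ 2.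
  apply: ler_pM => //; first by rewrite !mulr_ge0// ltW.
    by rewrite divr_ge0 ?sqr_ge0.
  exact: le_trans L.
have := ler_wpM2l (ltW e0) YY.
by clear -gE; lra.
Unshelve. all: by end_near. Qed.

Lemma ising_dist_after (e : R) : 0 < e -> exists g0 : R, forall g, g0 <= g ->
  \forall n \near \oo, 0 <= ising_dist beta n (Num.truncn (tn n + g * n%:R)) <= e.
Proof.
move=> e0; have /andP[b0 b1] := beta01.
have q0 : 0 < q by lra.
pose C : R := 2 * Num.sqrt (8 / ((1 - tanh 2) / 2)).
have C0 : 0 <= C by rewrite mulr_ge0 ?sqrtr_ge0.
have E0 : 0 < expR 2 :> R by exact: expR_gt0.
(* The [4] leaves room for the first stage and for smoothing; the other term gives
   [(4 + C) * expR 2 <= q * e * g / 4], used with [exp x >= 1 + x]. *)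
exists (Num.max 4 (4 * (4 + C) * expR 2 / (q * e))) => g.
rewrite ge_max => /andP[g4 gE].
rewrite ler_pdivrMr ?mulr_gt0// in gE.
near=> n.
have N2 : 2 <= n%:R :> R by near: n; exact: near_natr_ge.
have Np : 8 / ((1 - tanh 2) / 2) <= n%:R :> R by near: n; exact: near_natr_ge.
have Ne : 48 / (q * e) <= n%:R by near: n; exact: near_natr_ge.
have n2 : (1 < n)%N by rewrite -(ltr_nat R); lra.
have n0 : (0 < n)%N by exact: ltnW.
have N0 : 0 < n%:R :> R by lra.
set T := Num.truncn _.
have /andP[-> _] := ising_dist_bounds beta T n0; rewrite andTb.
have tn0 : 0 <= tn n by rewrite mulr_ge0 ?ln_ge0 ?ler1n// mulr_ge0// invr_ge0; lra.
have gn0 : 0 <= g * n%:R by rewrite mulr_ge0//; lra.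
have /andP[_ T1] := truncn_itv (addr_ge0 tn0 gn0); rewrite -/T in T1.
have gn20 : 0 <= g * n%:R / 2 by lra.
have /andP[t0l t0u] := truncn_itv gn20.
(* Half of the extra time goes to the first stage and [n] steps to smoothing. Another [n] absorbs
   the rounding, leaving at least [tn n + (g / 2 - 2) * n] steps of contraction. *)
set t0 := Num.truncn (g * n%:R / 2) in t0l t0u.
have gN : 4 * n%:R <= g * n%:R by rewrite ler_pM2r.
have Tge : (t0 + n <= T)%N.
  rewrite -(ler_nat R) natrD; clear -N2 tn0 T1 t0l gN.
  move: tn0 T1; set a := tn n; set b := g * n%:R in t0l gN *. lra.
have TE : T = (t0 + ((T - (t0 + n)) + n))%N by rewrite addnCA subnK.
rewrite TE; set t := (T - (t0 + n))%N.
have tR : t%:R = T%:R - t0%:R - n%:R :> R by rewrite natrB// natrD; ring.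
apply: (le_trans (ising_dist_le beta01 n2 Np t0 t)).
have U := @rho_upper R beta beta01 n t (g / 2 - 2) n2.
have {}U : Num.sqrt n%:R * (1 - q / n%:R) ^+ t <= expR (2 - q * g / 2).
  apply: le_trans (U _) _.
    rewrite tR; clear -N2 T1 t0l; move: T1; set a := tn n; clearbody a.
    have -> : (g / 2 - 2) * n%:R = g * n%:R / 2 - 2 * n%:R by ring.
    by set b := g * n%:R in t0l *; lra.
  by rewrite ler_expR; clear -b0; lra.
have V : (1 - q / n%:R) ^+ (2 * t0) <= expR (2 - q * g / 2).
  apply: (le_trans (rho_exp_le beta01 _ n2)); rewrite ler_expR natrM.
  suff : q * g - 2 <= q * (2 * t0%:R) / n%:R.
    have : 0 <= q * g by rewrite mulr_ge0 ?(ltW q0)//; apply: le_trans g4.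
    by clear; lra.
  rewrite ler_pdivlMr//.
  have : q * (g * n%:R / 2) <= q * (t0%:R + 1) by rewrite ler_pM2l// natr1 ltW.
  have : q <= n%:R by clear -b0 N2; lra.
  by clear; lra.
have W : expR (2 - q * g / 2) * (4 + C) <= e / 2.
  have X := expR_ge1Dx (q * g / 2).
  have X0 := expR_gt0 (q * g / 2).
  rewrite expRD expRN mulrAC ler_pdivrMr//.
  have : e / 2 * (1 + q * g / 2) <= e / 2 * expR (q * g / 2).
    by rewrite ler_pM2l// divr_gt0.
  by clear -gE e0; clearbody C; lra.
have Z : 24 / q / n%:R <= e / 2.
  rewrite ler_pdivrMr ?mulr_gt0// in Ne.
  by rewrite ler_pdivrMr// ler_pdivrMr//; clear -Ne; lra.
have U2 := ler_wpM2l C0 U.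
have -> : 6 / q / n%:R = 24 / q / n%:R / 4 by field; rewrite !gt_eqF.
rewrite -/C -[C * _ * _]mulrA; move: V W Z U2; clear.
set E := expR _; set x := _ ^+ (2 * t0); set y := 24 / q / _; set z := Num.sqrt _ * _.
by clearbody C E x y z; lra.
Unshelve. all: by end_near. Qed.

End Cutoff.

Theorem theorem1 (R : realType) (beta : R) (hbeta : 0 <= beta < 1) :
  cutoff (ising_dist beta)
    (fun n : nat => (2 * (1 - beta))^-1 * n%:R * ln n%:R)
    (fun n : nat => n%:R).
Proof.
split; first exact: window_littleo.
- apply: cvge_pinfty_bounds => e e0.
  have [g0 H] := ising_dist_before hbeta e0; exists g0 => g /H Hg.
  have /andP[-> h] := limn_einf_bounds Hg.
  by apply: le_trans h _; rewrite lee_fin lerDl ltW.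
- apply: cvge_pinfty_bounds => e e0.
  have [g0 H] := ising_dist_after hbeta e0; exists g0 => g /H Hg.
  have /andP[h k] := limn_esup_bounds Hg.
  apply/andP; split; [apply: le_trans h | apply: (le_trans k)]; rewrite lee_fin.
    by rewrite sub0r oppr_le0 ltW.
  by rewrite add0r.
Qed.
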